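(* In $\mathbf{ZF}$, the following conditions are equivalent: (i) $\mathbf{CAC}$: every denumerable family of non-empty sets has a choice function; (ii) $\mathbf{CMC}(\aleph_0,\infty)$ (for every countable family $\mathcal{F}$ of non-empty sets there is a function $f$ on $\mathcal{F}$ such that, for every $x\in\mathcal{F}$, $f(x)$ is a non-empty countable subset of $x$) holds, and for every infinite set $X$, $[X]^{\leq\omega}$ is a $\sigma$-ideal; (iii) for every infinite set $X$, $2^X[[X]^{\leq\omega}]$ is a $P$-space; (iv) for every infinite set $X$, $\mathbf{S}_{\mathcal{P}}(X,[X]^{\leq\omega})$ is a $P$-space.
   Context: The background theory is $\mathbf{ZF}$ (no axiom of choice). A set is denumerable if it is equipotent to $\omega$, and countable if it injects into $\omega$. $[X]^{\leq\omega}$ is the set of countable subsets of $X$. A $\sigma$-ideal is an ideal of sets closed under unions of sequences indexed by $\omega$. For an infinite set $X$ and $\mathcal{Z}=[X]^{\leq\omega}$: $\mathbf{S}_{\mathcal{P}}(X,\mathcal{Z})$ is the set $\mathcal{P}(X)$ with the topology consisting of all $V\subseteq\mathcal{P}(X)$ such that for every $x\in V$ there is $z\in\mathcal{Z}$ with $x\cap z=\emptyset$ and $\{y\in\mathcal{P}(X):x\subseteq y\subseteq X\setminus z\}\subseteq V$. With $2=\{0,1\}$ and $[p]_X=\{f\in 2^X:p\subseteq f\}$ for $p\in 2^z$, $z\in\mathcal{Z}\setminus\{\emptyset\}$, $2^X[\mathcal{Z}]$ is the set $2^X$ with the topology $\{V\subseteq 2^X:(\forall f\in V)(\exists z\in\mathcal{Z}\setminus\{\emptyset\})(\exists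 p\in 2^z)\ f\in[p]_X\subseteq V\}$. A $P$-space is a topological space in which every $G_\delta$-set (countable intersection of open sets) is open. *)

(* Defs.v *)
(* Plain Rocq, no library beyond the prelude.

   A theorem of ZF is read as a statement true in every model of the
   first-order theory ZF.  The Separation and Replacement schemata range over
   first-order formulas with parameters only, so no choice principle of the
   metatheory transfers to the models.  All set-theoretic notions below
   quantify over elements of the structure only (never over predicates or
   types), so each closed one is literally the interpretation of a first-order
   sentence in the language {∈, =}. *)

Set Implicit Arguments.
Unset Strict Implicit.
Unset Printing Implicit Defensive.

Record set_structure : Type := SetStructure {
  carrier :> Type;
  mem : carrier -> carrier -> Prop
}.

Arguments mem {s} _ _.

Declare Scope zf_scope.
Delimit Scope zf_scope with zf.
Local Open Scope zf_scope.

Notation "x ∈ y" := (mem x y) (at level 70, no associativity) : zf_scope.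
Notation "x ∉ y" := (~ mem x y) (at level 70, no associativity) : zf_scope.
(* The structure has no function symbols, so a set is specified by the property
   that defines its elements. *)
Notation "s ≐ {{ x | P }}" := (forall x, mem x s <-> P)
  (at level 70, x name, P at level 200, no associativity) : zf_scope.

(* First-order formulas over {∈, =}, with de Bruijn indices: a quantifier binds
   index 0 and shifts the others. *)
Inductive formula : Type :=
| f_mem (i j : nat)
| f_eq (i j : nat)
| f_bot
| f_imp (phi psi : formula)
| f_and (phi psi : formula)
| f_or (phi psi : formula)
| f_all (phi : formula)
| f_ex (phi : formula).

Definition scons (A : Type) (a : A) (e : nat -> A) : nat -> A :=
  fun n => match n with O => a | S n' => e n' end.

Fixpoint sat (M : set_structure) (e : nat -> M) (phi : formula) : Prop :=
  match phi with
  | f_mem i j => e i ∈ e j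
  | f_eq i j => e i = e j
  | f_bot => False
  | f_imp phi psi => sat e phi -> sat e psi
  | f_and phi psi => sat e phi /\ sat e psi
  | f_or phi psi => sat e phi \/ sat e psi
  | f_all phi => forall a : M, sat (scons a e) phi
  | f_ex phi => exists a : M, sat (scons a e) phi
  end.

Definition subset (M : set_structure) (x y : M) : Prop :=
  forall a, a ∈ x -> a ∈ y.
Notation "x ⊆ y" := (subset x y) (at level 70, no associativity) : zf_scope.

Definition is_empty (M : set_structure) (x : M) : Prop := forall a, a ∉ x.

Definition nonempty (M : set_structure) (x : M) : Prop := exists a, a ∈ x.

Definition is_upair (M : set_structure) (p a b : M) : Prop :=
  p ≐ {{ x | x = a \/ x = b }}.

Definition is_union (M : set_structure) (u F : M) : Prop :=
  u ≐ {{ x | exists y, y ∈ F /\ x ∈ y }}.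

Definition is_power (M : set_structure) (P X : M) : Prop :=
  P ≐ {{ x | x ⊆ X }}.

Definition is_cup (M : set_structure) (c x y : M) : Prop :=
  c ≐ {{ a | a ∈ x \/ a ∈ y }}.

Definition is_cap (M : set_structure) (c x y : M) : Prop :=
  c ≐ {{ a | a ∈ x /\ a ∈ y }}.

Definition is_diff (M : set_structure) (d x y : M) : Prop :=
  d ≐ {{ a | a ∈ x /\ a ∉ y }}.

Definition disjoint (M : set_structure) (x y : M) : Prop :=
  forall a, ~ (a ∈ x /\ a ∈ y).

(* s is the von Neumann successor n ∪ {n} *)
Definition is_succ (M : set_structure) (s n : M) : Prop :=
  s ≐ {{ x | x ∈ n \/ x = n }}.

Definition inductive (M : set_structure) (w : M) : Prop :=
  (exists e, is_empty e /\ e ∈ w) /\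
  (forall n, n ∈ w -> exists s, is_succ s n /\ s ∈ w).

Record ZF_model (M : set_structure) : Prop := {
  zf_extensionality : forall x y : M, (forall a, a ∈ x <-> a ∈ y) -> x = y;
  zf_foundation : forall x : M, nonempty x -> exists y, y ∈ x /\ disjoint y x;
  zf_pairing : forall a b : M, exists p, is_upair p a b;
  zf_union : forall F : M, exists u, is_union u F;
  zf_power : forall X : M, exists P, is_power P X;
  zf_infinity : exists w : M, inductive w;
  zf_separation : forall (phi : formula) (e : nat -> M) (A : M),
    exists B : M, B ≐ {{ x | x ∈ A /\ sat (scons x e) phi }};
  (* phi has x as index 1, its value y as index 0, parameters from index 2 *)
  zf_replacement : forall (phi : formula) (e : nat -> M) (A : M),
    (forall x y y', x ∈ A ->
       sat (scons y (scons x e)) phi -> sat (scons y' (scons x e)) phi ->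
       y = y') ->
    exists B : M,
      B ≐ {{ y | exists x, x ∈ A /\ sat (scons y (scons x e)) phi }}
}.

Definition is_omega (M : set_structure) (w : M) : Prop :=
  inductive w /\ forall v, inductive v -> w ⊆ v.

(* Kuratowski pair {{a}, {a, b}} *)
Definition is_opair (M : set_structure) (p a b : M) : Prop :=
  exists u v, is_upair u a a /\ is_upair v a b /\ is_upair p u v.

(* f(a) = b *)
Definition maps (M : set_structure) (f a b : M) : Prop :=
  exists p, is_opair p a b /\ p ∈ f.

Definition function_on (M : set_structure) (f A : M) : Prop :=
  (forall p, p ∈ f -> exists a b, a ∈ A /\ is_opair p a b) /\
  (forall a, a ∈ A -> exists! b, maps f a b).

Definition function_to (M : set_structure) (f A B : M) : Prop :=
  function_on f A /\ forall a b, maps f a b -> b ∈ B.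

Definition injective (M : set_structure) (f : M) : Prop :=
  forall a a' b, maps f a b -> maps f a' b -> a = a'.

Definition surjective (M : set_structure) (f B : M) : Prop :=
  forall b, b ∈ B -> exists a, maps f a b.

Definition equipotent (M : set_structure) (A B : M) : Prop :=
  exists f, function_to f A B /\ injective f /\ surjective f B.

Definition finite (M : set_structure) (A : M) : Prop :=
  exists w n, is_omega w /\ n ∈ w /\ equipotent A n.

Definition infinite (M : set_structure) (A : M) : Prop := ~ finite A.

Definition denumerable (M : set_structure) (A : M) : Prop :=
  exists w, is_omega w /\ equipotent A w.

Definition countable (M : set_structure) (A : M) : Prop :=
  exists w f, is_omega w /\ function_to f A w /\ injective f.

(* Z = [X]^{≤ω} *)
Definition is_countable_subsets (M : set_structure) (Z X : M) : Prop :=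
  Z ≐ {{ z | z ⊆ X /\ countable z }}.

Definition CAC (M : set_structure) : Prop :=
  forall F : M, denumerable F -> (forall x, x ∈ F -> nonempty x) ->
  exists f, function_on f F /\ forall x y, maps f x y -> y ∈ x.

(* CMC(ℵ₀, ∞) *)
Definition CMC_aleph0_infty (M : set_structure) : Prop :=
  forall F : M, countable F -> (forall x, x ∈ F -> nonempty x) ->
  exists f, function_on f F /\
    forall x y, maps f x y -> nonempty y /\ countable y /\ y ⊆ x.

(* Properness is not part of the definition: [ω]^{≤ω} is the whole power set
   of ω. *)
Definition ideal (M : set_structure) (I : M) : Prop :=
  (exists e, is_empty e /\ e ∈ I) /\
  (forall x y, x ∈ I -> y ⊆ x -> y ∈ I) /\
  (forall x y u, x ∈ I -> y ∈ I -> is_cup u x y -> u ∈ I).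

Definition sigma_ideal (M : set_structure) (I : M) : Prop :=
  ideal I /\
  forall w s u, is_omega w -> function_to s w I ->
    u ≐ {{ a | exists n x, maps s n x /\ a ∈ x }} -> u ∈ I.

Definition countable_subsets_sigma_ideal (M : set_structure) : Prop :=
  forall X Z : M, infinite X -> is_countable_subsets Z X -> sigma_ideal Z.

Definition topology (M : set_structure) (S T : M) : Prop :=
  (forall U, U ∈ T -> U ⊆ S) /\
  S ∈ T /\
  (forall U V W, U ∈ T -> V ∈ T -> is_cap W U V -> W ∈ T) /\
  (forall A W, A ⊆ T -> is_union W A -> W ∈ T).

Definition G_delta (M : set_structure) (S T G : M) : Prop :=
  exists A, A ⊆ T /\ countable A /\
    G ≐ {{ x | x ∈ S /\ forall U, U ∈ A -> x ∈ U }}.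

Definition P_space (M : set_structure) (S T : M) : Prop :=
  topology S T /\ forall G, G_delta S T G -> G ∈ T.

(* (S, T) is the space S_P(X, Z) *)
Definition is_SP_space (M : set_structure) (X Z S T : M) : Prop :=
  is_power S X /\
  T ≐ {{ V | V ⊆ S /\
    forall x, x ∈ V -> exists z, z ∈ Z /\ disjoint x z /\
      exists d, is_diff d X z /\
        forall y, y ∈ S -> x ⊆ y -> y ⊆ d -> y ∈ V }}.

Definition is_two (M : set_structure) (t : M) : Prop :=
  t ≐ {{ x | is_empty x \/ x ≐ {{ y | is_empty y }} }}.

Definition is_function_space (M : set_structure) (S A B : M) : Prop :=
  S ≐ {{ f | function_to f A B }}.

(* c = [p]_X, where S = 2^X *)
Definition is_cylinder (M : set_structure) (S c p : M) : Prop :=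
  c ≐ {{ f | f ∈ S /\ p ⊆ f }}.

(* (S, T) is the space 2^X[Z] *)
Definition is_cube_space (M : set_structure) (X Z S T : M) : Prop :=
  exists t, is_two t /\ is_function_space S X t /\
  T ≐ {{ V | V ⊆ S /\
    forall f, f ∈ V -> exists z, z ∈ Z /\ nonempty z /\
      exists p c, function_to p z t /\ is_cylinder S c p /\ f ∈ c /\ c ⊆ V }}.

Definition cube_spaces_P (M : set_structure) : Prop :=
  forall X Z S T : M, infinite X -> is_countable_subsets Z X ->
    is_cube_space X Z S T -> P_space S T.

Definition SP_spaces_P (M : set_structure) : Prop :=
  forall X Z S T : M, infinite X -> is_countable_subsets Z X ->
    is_SP_space X Z S T -> P_space S T.

(* Main.v *)
(** Each implication into CAC comes down to one countable set [z] that meets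
    every member of the given family: the least element of its intersection with a
    member, in a fixed enumeration of [z], is then a choice.  Under (ii), [z] is
    the union of the countable sets supplied by CMC.  Under (iii) or (iv), take
    an infinite [X] containing all members; for each member [x] the points that
    vanish (respectively, whose complement is nonempty) somewhere on [x] form an
    open set, and openness of the intersection of these sets at the point 0
    (respectively, the empty set) yields [z].

    Conversely, under CAC one may choose, for countably many requirements, a
    countable set together with an enumeration of it, and an injection of
    [ω × ω] into [ω] shows that the union is countable; this gives the
    σ-ideal property and the openness of G_δ sets at once.

    Separation and Replacement apply to first-order formulas only, so every
    predicate used with them is shown to be [definable] (with parameters). *)

From Stdlib Require Import Arith Classical ClassicalEpsilon.
Require Import Defs.

Set Implicit Arguments.
Unset Strict Implicit.
Unset Printing Implicit Defensive.

Local Open Scope zf_scope.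

(** * Definability with parameters *)

Fixpoint rename (r : nat -> nat) (phi : formula) : formula :=
  let up := fun i => match i with O => O | S j => S (r j) end in
  match phi with
  | f_mem i j => f_mem (r i) (r j)
  | f_eq i j => f_eq (r i) (r j)
  | f_bot => f_bot
  | f_imp a b => f_imp (rename r a) (rename r b)
  | f_and a b => f_and (rename r a) (rename r b)
  | f_or a b => f_or (rename r a) (rename r b)
  | f_all a => f_all (rename up a)
  | f_ex a => f_ex (rename up a)
  end.

(** Under a quantifier the lifted renaming fixes index 0, so the relation between the two
    environments is inherited by the extended ones. *)
Lemma sat_rename (M : set_structure) (phi : formula) :
  forall (r : nat -> nat) (e e' : nat -> M), (forall i, e (r i) = e' i) ->
  sat e (rename r phi) <-> sat e' phi.
Proof.
  induction phi as [i j|i j| |p IHp q IHq|p IHp q IHq|p IHp q IHq|p IHp|p IHp];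
    intros r e e' H; simpl;
    try (rewrite !H; tauto); try tauto;
    try (rewrite (IHp r e e' H), (IHq r e e' H); tauto).
  - assert (E : forall a : M, sat (scons a e) (rename (fun i =>
      match i with O => O | S j => S (r j) end) p) <-> sat (scons a e') p).
    { intro a; apply IHp; intros [|i]; simpl; auto. }
    split; intros K a; apply E; auto.
  - assert (E : forall a : M, sat (scons a e) (rename (fun i =>
      match i with O => O | S j => S (r j) end) p) <-> sat (scons a e') p).
    { intro a; apply IHp; intros [|i]; simpl; auto. }
    split; intros [a K]; exists a; apply E; auto.
Qed.

Section Definability.
Variable M : set_structure.

(* A formula variable is interpreted either by an entry of the environment or
   by a fixed parameter. *)
Definition interp (r : nat -> nat + M) (e : nat -> M) : nat -> M :=
  fun i => match r i with inl j => e j | inr c => c end.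

Definition definable (P : (nat -> M) -> Prop) : Prop :=
  exists r phi, forall e, P e <-> sat (interp r e) phi.

(** The language has no function symbols, so an operation is represented by its graph: entry 0 holds
    the value and the arguments are shifted by one. *)
Definition definable_term (t : (nat -> M) -> M) : Prop :=
  definable (fun e => e 0 = t (fun i => e (S i))).

Lemma definable_ext (P Q : (nat -> M) -> Prop) :
  (forall e, P e <-> Q e) -> definable P -> definable Q.
Proof.
  intros E (r & phi & H); exists r, phi; intro e; rewrite <- E; apply H.
Qed.

(** The two formulas come with different interpretations of their variables. Interleaving them, even
    variables for [P] and odd ones for [Q], gives a common interpretation, after which a connective
    can be applied. *)
Lemma definable2 (P Q : (nat -> M) -> Prop) :
  definable P -> definable Q ->
  exists r phi psi, forall e,
    (P e <-> sat (interp r e) phi) /\ (Q e <-> sat (interp r e) psi).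
Proof.
  intros (r & phi & H) (r' & psi & H').
  exists (fun i => if Nat.even i then r (Nat.div2 i) else r' (Nat.div2 i)).
  exists (rename (fun i => 2 * i) phi), (rename (fun i => S (2 * i)) psi).
  intro e; split.
  - rewrite H; symmetry; apply sat_rename; intro i; unfold interp.
    rewrite Nat.even_even, Nat.div2_double; reflexivity.
  - rewrite H'; symmetry; apply sat_rename; intro i; unfold interp.
    rewrite Nat.div2_succ_double.
    replace (S (2 * i)) with (2 * i + 1) by (rewrite Nat.add_1_r; reflexivity).
    rewrite Nat.even_odd; reflexivity.
Qed.

Lemma definable_and (P Q : (nat -> M) -> Prop) :
  definable P -> definable Q -> definable (fun e => P e /\ Q e).
Proof.
  intros HP HQ; destruct (definable2 HP HQ) as (r & p & q & H).
  exists r, (f_and p q); intro e; destruct (H e); simpl; tauto.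
Qed.

Lemma definable_or (P Q : (nat -> M) -> Prop) :
  definable P -> definable Q -> definable (fun e => P e \/ Q e).
Proof.
  intros HP HQ; destruct (definable2 HP HQ) as (r & p & q & H).
  exists r, (f_or p q); intro e; destruct (H e); simpl; tauto.
Qed.

Lemma definable_imp (P Q : (nat -> M) -> Prop) :
  definable P -> definable Q -> definable (fun e => P e -> Q e).
Proof.
  intros HP HQ; destruct (definable2 HP HQ) as (r & p & q & H).
  exists r, (f_imp p q); intro e; destruct (H e); simpl; tauto.
Qed.

Lemma definable_iff (P Q : (nat -> M) -> Prop) :
  definable P -> definable Q -> definable (fun e => P e <-> Q e).
Proof. intros HP HQ; apply definable_and; apply definable_imp; assumption. Qed.

Lemma definable_False : definable (fun _ => False).
Proof. exists (fun i => inl i), f_bot; simpl; tauto. Qed.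

Lemma definable_True : definable (fun _ => True).
Proof. exists (fun i => inl i), (f_imp f_bot f_bot); simpl; tauto. Qed.

Lemma definable_not (P : (nat -> M) -> Prop) :
  definable P -> definable (fun e => ~ P e).
Proof. intro H; apply (definable_imp H definable_False). Qed.

(* Turns the environment entry 0 into the formula variable 0. *)
Lemma definable_scons (c : M) (Q : (nat -> M) -> M -> Prop) :
  definable (fun e => Q (fun i => e (S i)) (e 0)) ->
  exists r phi, forall e a, Q e a <-> sat (scons a (interp r e)) phi.
Proof.
  intros (r & phi & H).
  (* Every variable that read entry 0 is renamed to index 0, so its old slot is never looked up and
     [c] is only a filler. *)
  exists (fun i => match r i with inl 0 => inr c | inl (S j) => inl j
                                | inr b => inr b end).
  exists (rename (fun i => match r i with inl 0 => 0 | _ => S i end) phi).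
  intros e a; rewrite (H (scons a e) : Q e a <-> _).
  symmetry; apply sat_rename; intro i; unfold interp.
  destruct (r i) as [[|j]|b] eqn:E; simpl; rewrite ?E; reflexivity.
Qed.

Lemma definable_all (Q : (nat -> M) -> M -> Prop) :
  definable (fun e => Q (fun i => e (S i)) (e 0)) ->
  definable (fun e => forall a, Q e a).
Proof.
  intro H; destruct (classic (inhabited M)) as [[c]|N].
  - destruct (definable_scons c H) as (r & phi & K).
    exists r, (f_all phi); intro e; split; intros L a; apply K; auto.
  (* An empty carrier admits no environment, so any formula serves. *)
  - exists (fun i => inl i), f_bot; intro e; destruct N; exact (inhabits (e 0)).
Qed.

Lemma definable_ex (Q : (nat -> M) -> M -> Prop) :
  definable (fun e => Q (fun i => e (S i)) (e 0)) ->
  definable (fun e => exists a, Q e a).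
Proof.
  intro H; destruct (classic (inhabited M)) as [[c]|N].
  - destruct (definable_scons c H) as (r & phi & K).
    exists r, (f_ex phi); intro e; split; intros [a L]; exists a; apply K; auto.
  - exists (fun i => inl i), f_bot; intro e; destruct N; exact (inhabits (e 0)).
Qed.

(** Interpretations compose. Hence entries of the environment may be permuted, duplicated or frozen
    to parameters. *)
Lemma definable_interp (g : nat -> nat + M) (P : (nat -> M) -> Prop) :
  definable P -> definable (fun e => P (interp g e)).
Proof.
  intros (r & phi & H).
  exists (fun i => match r i with inl j => g j | inr c => inr c end), phi.
  intro e; rewrite H, <- (sat_rename phi (r := fun i => i)
    (e := interp r (interp g e))) by (intro; reflexivity).
  apply sat_rename; intro i; unfold interp.
  destruct (r i) as [j|c]; reflexivity.
Qed.

Lemma definable_env (g : nat -> nat) (P : (nat -> M) -> Prop) :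
  definable P -> definable (fun e => P (fun i => e (g i))).
Proof. exact (definable_interp (fun i => inl (g i)) (P := P)). Qed.

Lemma definable_term_var (i : nat) : definable_term (fun e => e i).
Proof.
  exists (fun j => inl j), (f_eq 0 (S i)); intro e; simpl; reflexivity.
Qed.

Lemma definable_term_const (c : M) : definable_term (fun _ => c).
Proof.
  exists (fun j => match j with 0 => inl 0 | _ => inr c end), (f_eq 0 1).
  intro e; simpl; reflexivity.
Qed.

(** A term in argument position is eliminated through [exists a, a = t e /\ Q e a], which mentions
    only the graph of the term. *)
Lemma definable_subst (Q : (nat -> M) -> M -> Prop) (t : (nat -> M) -> M) :
  definable (fun e => Q (fun i => e (S i)) (e 0)) -> definable_term t ->
  definable (fun e => Q e (t e)).
Proof.
  intros HQ Ht.
  apply definable_ext with (fun e => exists a, a = t e /\ Q e a).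
  - intro e; split; [intros (a & -> & K); exact K | eauto].
  - apply (definable_ex (Q := fun e a => a = t e /\ Q e a)).
    apply definable_and; assumption.
Qed.

Lemma definable_mem (s t : (nat -> M) -> M) :
  definable_term s -> definable_term t -> definable (fun e => s e ∈ t e).
Proof.
  intros Hs Ht.
  apply (definable_subst (Q := fun e a => a ∈ t e)); [|exact Hs].
  apply (definable_subst (Q := fun e b => e 0 ∈ b)).
  - exists (fun j => inl j), (f_mem 1 0); intro e; simpl; reflexivity.
  - apply (definable_env (fun i => match i with 0 => 0 | S j => S (S j) end) Ht).
Qed.

Lemma definable_eq (s t : (nat -> M) -> M) :
  definable_term s -> definable_term t -> definable (fun e => s e = t e).
Proof.
  intros Hs Ht.
  apply (definable_subst (Q := fun e a => a = t e)); [exact Ht | exact Hs].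
Qed.

Lemma definable_exu (Q : (nat -> M) -> M -> Prop) :
  definable (fun e => Q (fun i => e (S i)) (e 0)) ->
  definable (fun e => exists! a, Q e a).
Proof.
  intro H; apply definable_ex with
    (Q := fun e a => Q e a /\ forall b, Q e b -> a = b).
  apply definable_and; [exact H|].
  apply definable_all with
    (Q := fun e b => Q (fun i => e (S i)) b -> e 0 = b).
  apply definable_imp.
  - apply (definable_env (fun i => match i with 0 => 0 | S j => S (S j) end) H).
  - apply definable_eq; apply definable_term_var.
Qed.

Lemma definable_term_subst (F : (nat -> M) -> M -> M) (t : (nat -> M) -> M) :
  definable_term (fun e => F (fun i => e (S i)) (e 0)) -> definable_term t ->
  definable_term (fun e => F e (t e)).
Proof.
  intros HF Ht.
  apply (definable_subst
    (Q := fun e a => e 0 = F (fun i => e (S i)) a)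
    (t := fun e => t (fun i => e (S i)))).
  - apply (definable_env (fun i => match i with 0 => 1 | 1 => 0
                                            | S j => S j end) HF).
  - apply (definable_env (fun i => match i with 0 => 0 | S j => S (S j) end) Ht).
Qed.

Lemma definable_term_fun (F : M -> M) (t : (nat -> M) -> M) :
  definable_term (fun e => F (e 0)) -> definable_term t ->
  definable_term (fun e => F (t e)).
Proof. apply (definable_term_subst (F := fun _ => F)). Qed.

Lemma definable_rel (R : M -> Prop) (t : (nat -> M) -> M) :
  definable (fun e => R (e 0)) -> definable_term t ->
  definable (fun e => R (t e)).
Proof. apply (definable_subst (Q := fun _ => R)). Qed.

Lemma definable_rel2 (R : M -> M -> Prop) (s t : (nat -> M) -> M) :
  definable (fun e => R (e 0) (e 1)) -> definable_term s -> definable_term t ->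
  definable (fun e => R (s e) (t e)).
Proof.
  intros HR Hs Ht.
  apply (definable_subst (Q := fun e a => R a (t e))); [|exact Hs].
  apply (definable_subst (Q := fun e b => R (e 0) b)).
  - apply (definable_env (fun i => match i with 0 => 1 | _ => 0 end) HR).
  - apply (definable_env (fun i => match i with 0 => 0 | S j => S (S j) end) Ht).
Qed.

Lemma definable_term_spec (Q : (nat -> M) -> M -> Prop) (t : (nat -> M) -> M) :
  definable (fun e => Q (fun i => e (S i)) (e 0)) ->
  (forall e y, Q e y <-> y = t e) -> definable_term t.
Proof.
  intros H E; refine (definable_ext _ H); intro e; apply E.
Qed.


Lemma definable_term_env (g : nat -> nat) (t : (nat -> M) -> M) :
  definable_term t -> definable_term (fun e => t (fun i => e (g i))).
Proof.
  apply (definable_env (fun i => match i with 0 => 0 | S j => S (g j) end)).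
Qed.

Lemma definable_term_fun2 (F : M -> M -> M) (s t : (nat -> M) -> M) :
  definable_term (fun e => F (e 0) (e 1)) ->
  definable_term s -> definable_term t ->
  definable_term (fun e => F (s e) (t e)).
Proof.
  intros HF Hs Ht.
  apply (definable_term_subst (F := fun e a => F a (t e))); [|exact Hs].
  apply (definable_term_subst (F := fun e b => F (e 0) b)).
  - apply (definable_term_env (fun i => match i with 0 => 1 | _ => 0 end) HF).
  - apply (definable_term_env (fun i => S i) Ht).
Qed.

End Definability.

(* Automation of definability goals *)
Create HintDb dfn.
Ltac dfn := cbv beta; solve [auto 100 with dfn nocore].

#[global] Hint Extern 0 (definable (fun _ => _ /\ _)) =>
  apply definable_and; cbv beta : dfn.
#[global] Hint Extern 0 (definable (fun _ => _ \/ _)) =>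
  apply definable_or; cbv beta : dfn.
#[global] Hint Extern 0 (definable (fun _ => _ <-> _)) =>
  apply definable_iff; cbv beta : dfn.
#[global] Hint Extern 0 (definable (fun _ => ~ _)) =>
  apply definable_not; cbv beta : dfn.
#[global] Hint Extern 0 (definable (fun _ => True)) =>
  apply definable_True : dfn.
#[global] Hint Extern 0 (definable (fun _ => exists! _, _)) =>
  apply definable_exu; cbv beta : dfn.
#[global] Hint Extern 1 (definable (fun _ => exists _, _)) =>
  apply definable_ex; cbv beta : dfn.
#[global] Hint Extern 0 (definable (fun _ => _ ∈ _)) =>
  apply definable_mem; cbv beta : dfn.
#[global] Hint Extern 0 (definable (fun _ => _ = _)) =>
  apply definable_eq; cbv beta : dfn.
#[global] Hint Extern 1 (definable _) =>
  lazymatch goal with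
  | |- definable (fun e => forall a : carrier _, _) =>
      apply definable_all; cbv beta
  | |- definable (fun e => _ -> _) => apply definable_imp; cbv beta
  | H : definable (fun e => ?R (e 0)) |- definable (fun e => ?R _) =>
      apply (definable_rel H); cbv beta
  | H : definable (fun e => ?R (e 0) (e 1)) |- definable (fun e => ?R _ _) =>
      apply (definable_rel2 H); cbv beta
  end : dfn.
#[global] Hint Extern 0 (definable (fun _ => subset _ _)) =>
  unfold subset : dfn.
#[global] Hint Extern 0 (definable (fun _ => disjoint _ _)) =>
  unfold disjoint : dfn.
#[global] Hint Extern 0 (definable (fun _ => is_empty _)) =>
  unfold is_empty : dfn.
#[global] Hint Extern 0 (definable (fun _ => is_upair _ _ _)) =>
  unfold is_upair : dfn.
#[global] Hint Extern 0 (definable (fun _ => is_succ _ _)) =>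
  unfold is_succ : dfn.
#[global] Hint Extern 0 (definable (fun _ => inductive _)) =>
  unfold inductive : dfn.
#[global] Hint Extern 0 (definable_term (fun e => e _)) =>
  apply definable_term_var : dfn.
#[global] Hint Extern 0 (definable_term (fun _ => ?c)) =>
  apply (definable_term_const c) : dfn.
#[global] Hint Extern 1 (definable_term _) =>
  lazymatch goal with
  | H : definable_term (fun e => ?F (e 0)) |- definable_term (fun e => ?F _) =>
      apply (definable_term_fun H); cbv beta
  | H : definable_term (fun e => ?F (e 0) (e 1))
      |- definable_term (fun e => ?F _ _) =>
      apply (definable_term_fun2 H); cbv beta
  end : dfn.

Section Model.
Variables (M : set_structure) (HM : ZF_model M).
Implicit Types (a b c f g m n p x y z A B F X Z : M).

Lemma set_ext x y : (forall a, a ∈ x <-> a ∈ y) -> x = y.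
Proof. apply (zf_extensionality HM). Qed.

(** * Set operations *)

Lemma separation (P : M -> Prop) A :
  definable (fun e => P (e 0)) -> exists B, B ≐ {{ x | x ∈ A /\ P x }}.
Proof.
  intros H; destruct (definable_scons A (Q := fun _ => P) H) as (r & phi & K).
  destruct (zf_separation HM phi (interp r (fun _ => A)) A) as [B HB].
  exists B; intro x; rewrite HB, K; reflexivity.
Qed.

Lemma replacement (R : M -> M -> Prop) A :
  definable (fun e => R (e 1) (e 0)) ->
  (forall x y y', x ∈ A -> R x y -> R x y' -> y = y') ->
  exists B, B ≐ {{ y | exists x, x ∈ A /\ R x y }}.
Proof.
  intros H Hf.
  destruct (definable_scons A (Q := fun e => R (e 0)) H) as (r & phi & K).
  (* Since [R] is evaluated at [x] alone, the environment may be taken constantly equal to [x]: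
     variables that read the environment go to index 1, the slot of [x] in the schema, and
     parameters go to indices from 2 on. *)
  pose (r' := fun i => match r i with inl _ => 1 | inr c => S (S i) end).
  pose (e' := fun i => match r i with inl _ => A | inr c => c end).
  assert (L : forall x y,
    R x y <-> sat (scons y (scons x e'))
      (rename (fun i => match i with 0 => 0 | S j => r' j end) phi)).
  { intros x y; rewrite (K (fun _ => x) y).
    symmetry; apply sat_rename; intros [|i]; [reflexivity|].
    unfold r', interp; simpl; destruct (r i) eqn:E; simpl; [reflexivity|].
    unfold e'; rewrite E; reflexivity. }
  destruct (@zf_replacement _ HM (rename _ phi) e' A
    (fun x y y' hx h h' => Hf x y y' hx (proj2 (L x y) h) (proj2 (L x y') h')))
    as [B HB].
  exists B; intro y; rewrite HB.
  split; intros (x & hx & h); exists x; split; auto; apply L; exact h.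
Qed.

(* [epsilon] only names sets that are unique by extensionality; the model gains
   no choice from it. *)
Definition sep A (P : M -> Prop) : M :=
  epsilon (inhabits A) (fun B => B ≐ {{ x | x ∈ A /\ P x }}).

Lemma sepE A (P : M -> Prop) : definable (fun e => P (e 0)) ->
  sep A P ≐ {{ x | x ∈ A /\ P x }}.
Proof.
  intro H; apply (epsilon_spec (inhabits A)
    (fun B => B ≐ {{ x | x ∈ A /\ P x }})).
  apply separation; exact H.
Qed.


(** By extensionality, a definable membership condition determines the value, hence defines the
    graph. Operations named by [epsilon] become definable terms in this way. *)
Lemma definable_term_ext (Q : (nat -> M) -> M -> Prop) (t : (nat -> M) -> M) :
  definable (fun e => Q (fun i => e (S i)) (e 0)) ->
  (forall e, t e ≐ {{ x | Q e x }}) ->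
  definable_term t.
Proof.
  intros HQ Ht.
  apply definable_term_spec with (Q := fun e y => y ≐ {{ x | Q e x }}).
  - apply definable_all, definable_iff; [dfn|].
    apply (definable_env (fun i => match i with 0 => 0 | S j => S (S j) end) HQ).
  - intros e y; split.
    + intro H; apply set_ext; intro x; rewrite H, Ht; reflexivity.
    + intros ->; apply Ht.
Qed.

Lemma definable_sep (A : (nat -> M) -> M) (P : (nat -> M) -> M -> Prop) :
  definable_term A -> definable (fun e => P (fun i => e (S i)) (e 0)) ->
  definable_term (fun e => sep (A e) (P e)).
Proof.
  intros HA HP.
  apply definable_term_ext with (Q := fun e x => x ∈ A e /\ P e x).
  - apply definable_and; [apply definable_mem; [dfn|]|exact HP].
    apply (definable_term_env S HA).
  - intro e; apply sepE.
    (* For a fixed [e] the entries of [e] turn into parameters, which leaves a predicate of entry 0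
       alone. *)
    apply (definable_interp
      (fun i => match i with 0 => inl 0 | S j => inr (e j) end) HP).
Qed.


Definition img A (F : M -> M) : M :=
  epsilon (inhabits A) (fun B => B ≐ {{ y | exists x, x ∈ A /\ y = F x }}).

Lemma imgE A (F : M -> M) : definable_term (fun e => F (e 0)) ->
  img A F ≐ {{ y | exists x, x ∈ A /\ y = F x }}.
Proof.
  intro H; apply (epsilon_spec (inhabits A)
    (fun B => B ≐ {{ y | exists x, x ∈ A /\ y = F x }})).
  apply replacement with (R := fun x y => y = F x).
  - dfn.
  - intros x y y' _ -> ->; reflexivity.
Qed.

Lemma definable_img (A : (nat -> M) -> M) (F : (nat -> M) -> M -> M) :
  definable_term A -> definable_term (fun e => F (fun i => e (S i)) (e 0)) ->
  definable_term (fun e => img (A e) (F e)).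
Proof.
  intros HA HF.
  apply definable_term_ext
    with (Q := fun e y => exists x, x ∈ A e /\ y = F e x).
  - apply definable_ex, definable_and;
      [apply definable_mem | apply definable_eq]; try dfn.
    + apply (definable_term_env (fun i => S (S i)) HA).
    + apply (definable_term_env
        (fun i => match i with 0 => 0 | S j => S (S j) end) HF).
  - intro e; apply imgE.
    apply (definable_interp (fun i => match i with
      0 => inl 0 | 1 => inl 1 | S (S j) => inr (e j) end) HF).
Qed.

Definition upr a b : M := epsilon (inhabits a) (fun p => is_upair p a b).

Lemma uprE a b : upr a b ≐ {{ x | x = a \/ x = b }}.
Proof.
  apply (epsilon_spec (inhabits a) (fun p => is_upair p a b)).
  apply (zf_pairing HM).
Qed.

Lemma definable_upr : definable_term (fun e : nat -> M => upr (e 0) (e 1)).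
Proof.
  apply definable_term_ext with (Q := fun e x => x = e 0 \/ x = e 1);
    [dfn | intro; apply uprE].
Qed.

Definition bigU F : M := epsilon (inhabits F) (fun u => is_union u F).

Lemma bigUE F : bigU F ≐ {{ x | exists y, y ∈ F /\ x ∈ y }}.
Proof.
  apply (epsilon_spec (inhabits F) (fun u => is_union u F)).
  apply (zf_union HM).
Qed.

Lemma definable_bigU : definable_term (fun e : nat -> M => bigU (e 0)).
Proof.
  apply definable_term_ext with (Q := fun e x => exists y, y ∈ e 0 /\ x ∈ y);
    [dfn | intro; apply bigUE].
Qed.

Definition pw X : M := epsilon (inhabits X) (fun P => is_power P X).

Lemma pwE X : pw X ≐ {{ x | x ⊆ X }}.
Proof.
  apply (epsilon_spec (inhabits X) (fun P => is_power P X)).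
  apply (zf_power HM).
Qed.

Lemma definable_pw : definable_term (fun e : nat -> M => pw (e 0)).
Proof.
  apply definable_term_ext with (Q := fun e x => x ⊆ e 0);
    [dfn | intro; apply pwE].
Qed.

Hint Extern 0 (definable_term (fun _ => sep _ _)) =>
  apply definable_sep; cbv beta : dfn.
Hint Extern 0 (definable_term (fun _ => img _ _)) =>
  apply definable_img; cbv beta : dfn.
Hint Extern 0 (definable_term (fun _ => upr _ _)) =>
  apply (definable_term_fun2 definable_upr); cbv beta : dfn.
Hint Extern 0 (definable_term (fun _ => bigU _)) =>
  apply (definable_term_fun definable_bigU); cbv beta : dfn.
Hint Extern 0 (definable_term (fun _ => pw _)) =>
  apply (definable_term_fun definable_pw); cbv beta : dfn.

Definition sing a : M := upr a a.

Lemma singE a : sing a ≐ {{ x | x = a }}.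
Proof. intro x; unfold sing; rewrite uprE; tauto. Qed.

Definition cup a b : M := bigU (upr a b).

Lemma cupE a b : cup a b ≐ {{ x | x ∈ a \/ x ∈ b }}.
Proof.
  intro x; unfold cup; rewrite bigUE; split.
  - intros (y & Hy & Hx); apply uprE in Hy; destruct Hy as [-> | ->]; tauto.
  - intros [H|H]; [exists a | exists b]; rewrite uprE; tauto.
Qed.

Definition opr a b : M := upr (sing a) (upr a b).

Lemma definable_sing :
  definable_term (fun e : nat -> M => sing (e 0)).
Proof. unfold sing; dfn. Qed.

Hint Extern 0 (definable_term (fun _ => sing _)) =>
  apply (definable_term_fun definable_sing); cbv beta : dfn.

Lemma definable_cup :
  definable_term (fun e : nat -> M => cup (e 0) (e 1)).
Proof. unfold cup; dfn. Qed.

Hint Extern 0 (definable_term (fun _ => cup _ _)) =>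
  apply (definable_term_fun2 definable_cup); cbv beta : dfn.

Lemma definable_opr :
  definable_term (fun e : nat -> M => opr (e 0) (e 1)).
Proof. unfold opr; dfn. Qed.

Hint Extern 0 (definable_term (fun _ => opr _ _)) =>
  apply (definable_term_fun2 definable_opr); cbv beta : dfn.

Lemma is_oprE p a b : is_opair p a b <-> p = opr a b.
Proof.
  split.
  - intros (u & v & Hu & Hv & Hp).
    assert (u = sing a) by (apply set_ext; intro x; rewrite (singE a x), (Hu x); tauto).
    assert (v = upr a b) by (apply set_ext; intro x; rewrite (uprE a b x), (Hv x); tauto).
    subst u v; apply set_ext; intro x.
    unfold opr; rewrite (uprE _ _ x), (Hp x); tauto.
  - intros ->; exists (sing a), (upr a b); unfold opr, sing.
    split; [|split]; intro x; rewrite uprE; tauto.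
Qed.

Lemma opr_inj a b a' b' : opr a b = opr a' b' -> a = a' /\ b = b'.
Proof.
  intro E.
  assert (Ea : a = a').
  { assert (H : sing a' ∈ opr a b) by (rewrite E; apply uprE; tauto).
    apply uprE in H; destruct H as [H|H].
    - apply singE; rewrite H; apply singE; reflexivity.
    - apply singE; rewrite H; apply uprE; tauto. }
  subst a'; split; [reflexivity|].
  assert (H : upr a b ∈ opr a b') by (rewrite <- E; apply uprE; tauto).
  assert (H' : upr a b' ∈ opr a b) by (rewrite E; apply uprE; tauto).
  assert (K : b = a \/ b = b').
  { apply uprE in H; destruct H as [H|H].
    - left; apply singE; rewrite <- H; apply uprE; tauto.
    - apply uprE; rewrite <- H; apply uprE; tauto. }
  (* In the degenerate case [b = a] the second coordinate is read off from [upr a b'] instead. *)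
  destruct K as [->|K]; [|exact K].
  apply uprE in H'; destruct H' as [H'|H'].
  - symmetry; apply singE; rewrite <- H'; apply uprE; tauto.
  - assert (L : b' ∈ upr a a) by (rewrite <- H'; apply uprE; tauto).
    apply uprE in L; intuition congruence.
Qed.

Lemma mapsE f a b : maps f a b <-> opr a b ∈ f.
Proof.
  split.
  - intros (p & Hp & H); apply is_oprE in Hp; subst; exact H.
  - intro H; exists (opr a b); rewrite is_oprE; tauto.
Qed.

Lemma definable_maps (f a b : (nat -> M) -> M) :
  definable_term f -> definable_term a -> definable_term b ->
  definable (fun e => maps (f e) (a e) (b e)).
Proof.
  intros Hf Ha Hb.
  apply definable_ext with (fun e => opr (a e) (b e) ∈ f e).
  - intro e; symmetry; apply mapsE.
  - apply definable_mem; [|exact Hf]; unfold opr.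
    repeat (apply (definable_term_fun2 definable_upr) || assumption).
Qed.

Hint Extern 0 (definable (fun _ => maps _ _ _)) =>
  apply definable_maps; cbv beta : dfn.

(** Both components of a Kuratowski pair are subsets of [cup A B], so the pair lies in the double
    power set. *)
Definition prod A B : M :=
  sep (pw (pw (cup A B))) (fun p => exists a b, a ∈ A /\ b ∈ B /\ p = opr a b).

Lemma prodE A B :
  prod A B ≐ {{ p | exists a b, a ∈ A /\ b ∈ B /\ p = opr a b }}.
Proof.
  intro p; unfold prod; rewrite sepE by dfn; split; [tauto|].
  intro H; split; [|exact H]; destruct H as (a & b & Ha & Hb & ->).
  apply pwE; intros u Hu; apply pwE; intros x Hx; apply cupE.
  apply uprE in Hu; destruct Hu as [-> | ->];
    [apply singE in Hx | apply uprE in Hx]; intuition congruence.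
Qed.

Lemma opr_prod A B a b : opr a b ∈ prod A B <-> a ∈ A /\ b ∈ B.
Proof.
  rewrite prodE; split.
  - intros (a' & b' & Ha & Hb & E); apply opr_inj in E; destruct E; subst; tauto.
  - intros []; exists a, b; tauto.
Qed.

Lemma definable_prod :
  definable_term (fun e : nat -> M => prod (e 0) (e 1)).
Proof. unfold prod; dfn. Qed.

Hint Extern 0 (definable_term (fun _ => prod _ _)) =>
  apply (definable_term_fun2 definable_prod); cbv beta : dfn.

(* When exactly one element of [A] satisfies [P], the union of [sep A P] is that
   element. *)
Definition pick A (P : M -> Prop) : M := bigU (sep A P).

Lemma pick_unique A (P : M -> Prop) a : definable (fun e => P (e 0)) ->
  a ∈ A -> P a -> (forall b, b ∈ A -> P b -> b = a) -> pick A P = a.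
Proof.
  intros D Ha HPa H; apply set_ext; intro x; unfold pick; rewrite bigUE; split.
  - intros (y & Hy & Hx); apply sepE in Hy; [|exact D].
    destruct Hy as [Hy Hy']; rewrite <- (H y); auto.
  - intro Hx; exists a; rewrite sepE by exact D; auto.
Qed.

Hint Extern 0 (definable_term (fun _ => pick _ _)) => unfold pick : dfn.

(** The double union of [f] contains both coordinates of each pair in [f], which bounds the search
    for the value. A point without a value is sent to the empty set. *)
Definition app f a : M := pick (bigU (bigU f)) (fun b => maps f a b).

Lemma opr_bigU f a b : opr a b ∈ f -> a ∈ bigU (bigU f) /\ b ∈ bigU (bigU f).
Proof.
  intro H; assert (K : upr a b ∈ bigU f).
  { apply bigUE; exists (opr a b); split; [exact H|apply uprE; tauto]. }
  split; apply bigUE; exists (upr a b); rewrite uprE; tauto.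
Qed.

Lemma definable_app :
  definable_term (fun e : nat -> M => app (e 0) (e 1)).
Proof. unfold app; dfn. Qed.

Hint Extern 0 (definable_term (fun _ => app _ _)) =>
  apply (definable_term_fun2 definable_app); cbv beta : dfn.

Lemma app_unique f a b : maps f a b -> (forall b', maps f a b' -> b' = b) ->
  app f a = b.
Proof.
  intros H U; apply pick_unique; [dfn| |exact H|intros b' _; apply U].
  apply mapsE in H; apply opr_bigU in H; tauto.
Qed.

Lemma app_on f A a b : function_on f A -> a ∈ A -> maps f a b <-> b = app f a.
Proof.
  intros [_ H] Ha; destruct (H a Ha) as (c & Hc & U).
  assert (E : app f a = c).
  { apply app_unique; [exact Hc|]; intros; symmetry; auto. }
  rewrite E; split; [intro; symmetry; auto | intros ->; exact Hc].
Qed.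

Lemma maps_dom f A a b : function_on f A -> maps f a b -> a ∈ A.
Proof.
  intros [H _] K; apply mapsE in K; destruct (H _ K) as (a' & b' & Ha & E).
  apply is_oprE in E; apply opr_inj in E; destruct E; subst; exact Ha.
Qed.

Definition lam A (F : M -> M) : M := img A (fun x => opr x (F x)).

Lemma maps_lam A (F : M -> M) a b : definable_term (fun e => F (e 0)) ->
  maps (lam A F) a b <-> a ∈ A /\ b = F a.
Proof.
  intro D; rewrite mapsE; unfold lam; rewrite imgE by dfn; split.
  - intros (x & Hx & E); apply opr_inj in E; destruct E; subst; auto.
  - intros [Ha ->]; exists a; auto.
Qed.

Lemma lam_on A (F : M -> M) : definable_term (fun e => F (e 0)) ->
  function_on (lam A F) A.
Proof.
  intro D; split.
  - intros p Hp; unfold lam in Hp; apply imgE in Hp; [|dfn].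
    destruct Hp as (x & Hx & ->); exists x, (F x); rewrite is_oprE; auto.
  - intros a Ha; exists (F a); split; [apply maps_lam; auto|].
    intros b Hb; apply maps_lam in Hb; [|exact D]; symmetry; tauto.
Qed.

Lemma app_lam A (F : M -> M) a : definable_term (fun e => F (e 0)) ->
  a ∈ A -> app (lam A F) a = F a.
Proof.
  intros D Ha; symmetry; apply (app_on _ (lam_on A D) Ha), maps_lam; auto.
Qed.

Lemma lam_to A B (F : M -> M) : definable_term (fun e => F (e 0)) ->
  (forall a, a ∈ A -> F a ∈ B) -> function_to (lam A F) A B.
Proof.
  intros D H; split; [apply lam_on, D|].
  intros a b K; apply maps_lam in K; [|exact D]; destruct K; subst; auto.
Qed.

Hint Extern 0 (definable_term (fun _ => lam _ _)) => unfold lam : dfn.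

(** * The natural numbers *)

Lemma model_inhabited : inhabited M.
Proof. destruct (zf_infinity HM) as [w _]; exact (inhabits w). Qed.

Definition emp : M := epsilon model_inhabited (fun x => is_empty x).

Lemma empE : is_empty emp.
Proof.
  apply (epsilon_spec model_inhabited (fun x => is_empty x)).
  destruct (zf_infinity HM) as [w [(e & He & _) _]]; exists e; exact He.
Qed.

Lemma emp_unique x : is_empty x -> x = emp.
Proof.
  intro H; apply set_ext; intro a; split; intro K;
    [destruct (H a K) | destruct (empE K)].
Qed.

Definition sc n : M := cup n (sing n).

Lemma scE n : sc n ≐ {{ x | x ∈ n \/ x = n }}.
Proof. intro x; unfold sc; rewrite cupE, singE; reflexivity. Qed.

Lemma is_succE s n : is_succ s n <-> s = sc n.
Proof.
  split; [|intros ->; exact (scE n)].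
  intro H; apply set_ext; intro x; rewrite (scE n x); apply H.
Qed.

Lemma definable_sc :
  definable_term (fun e : nat -> M => sc (e 0)).
Proof. unfold sc; dfn. Qed.

Hint Extern 0 (definable_term (fun _ => sc _)) =>
  apply (definable_term_fun definable_sc); cbv beta : dfn.

Definition om : M :=
  epsilon model_inhabited (fun w => is_omega w).

(** The intersection of all inductive sets is carved out of one that Infinity provides. *)
Lemma om_spec : is_omega om.
Proof.
  apply (epsilon_spec model_inhabited (fun w => is_omega w)).
  destruct (zf_infinity HM) as [w Hw].
  assert (E : sep w (fun x => forall v, inductive v -> x ∈ v)
              ≐ {{ x | x ∈ w /\ forall v, inductive v -> x ∈ v }})
    by (apply sepE; dfn).
  exists (sep w (fun x => forall v, inductive v -> x ∈ v)).
  split; [split|].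
  - exists emp; split; [apply empE|]; apply E; split.
    + destruct Hw as [(e & He & H) _]; rewrite <- (emp_unique He); exact H.
    + intros v [(e & He & H) _]; rewrite <- (emp_unique He); exact H.
  - intros n Hn; apply E in Hn; destruct Hn as [Hn K].
    exists (sc n); split; [exact (scE n)|]; apply E; split.
    + destruct Hw as [_ H]; destruct (H n Hn) as (s & Hs & Hsw).
      apply is_succE in Hs; subst; exact Hsw.
    + intros v Hv; pose proof (K v Hv) as L; destruct Hv as [_ H].
      destruct (H n L) as (s & Hs & Hsw); apply is_succE in Hs; subst; exact Hsw.
  - intros v Hv x Hx; apply E in Hx; apply Hx; exact Hv.
Qed.

Lemma omega_unique w : is_omega w -> w = om.
Proof.
  intros [H K]; destruct om_spec as [H' K'].
  apply set_ext; intro x; split; [apply K, H' | apply K', H].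
Qed.

Lemma emp_om : emp ∈ om.
Proof.
  destruct om_spec as [[(e & He & H) _] _].
  rewrite <- (emp_unique He); exact H.
Qed.

Lemma sc_om n : n ∈ om -> sc n ∈ om.
Proof.
  intro Hn; destruct om_spec as [[_ H] _]; destruct (H n Hn) as (s & Hs & K).
  apply is_succE in Hs; subst; exact K.
Qed.

Lemma om_ind (P : M -> Prop) : definable (fun e => P (e 0)) ->
  P emp -> (forall n, n ∈ om -> P n -> P (sc n)) -> forall n, n ∈ om -> P n.
Proof.
  intros D H0 HS n Hn.
  assert (E := sepE om D).
  assert (I : inductive (sep om P)).
  { split.
    - exists emp; split; [apply empE|]; apply E; split; [apply emp_om|exact H0].
    - intros k Hk; apply E in Hk; exists (sc k); split; [exact (scE k)|].
      apply E; split; [apply sc_om|apply HS]; tauto. }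
  apply (proj2 om_spec _ I), E in Hn; tauto.
Qed.

Lemma mem_irrefl x : x ∉ x.
Proof.
  intro H; destruct (zf_foundation HM (x := sing x)) as (y & Hy & D).
  - exists x; apply singE; reflexivity.
  - apply singE in Hy; subst y; apply (D x); rewrite singE; tauto.
Qed.

Lemma mem_asym x y : x ∈ y -> y ∉ x.
Proof.
  intros H K; destruct (zf_foundation HM (x := upr x y)) as (z & Hz & D).
  - exists x; apply uprE; tauto.
  - apply uprE in Hz; destruct Hz; subst z;
      [apply (D y) | apply (D x)]; rewrite uprE; tauto.
Qed.

(** Foundation excludes the one bad case, [m ∈ n] together with [n ∈ m]. *)
Lemma sc_inj m n : sc m = sc n -> m = n.
Proof.
  intro E; assert (H : m ∈ sc n) by (rewrite <- E; apply scE; tauto).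
  assert (K : n ∈ sc m) by (rewrite E; apply scE; tauto).
  apply scE in H; apply scE in K; destruct H as [H|H]; [|exact H].
  destruct K as [K|K]; [|symmetry; exact K].
  destruct (mem_asym H K).
Qed.

Lemma sc_neq_emp n : sc n <> emp.
Proof. intro E; apply (@empE n); rewrite <- E; apply scE; tauto. Qed.

Lemma om_cases n : n ∈ om -> n = emp \/ exists m, m ∈ om /\ n = sc m.
Proof.
  apply (om_ind (P := fun n => n = emp \/ exists m, m ∈ om /\ n = sc m)).
  - dfn.
  - tauto.
  - intros m Hm _; right; exists m; tauto.
Qed.

Lemma om_trans n : n ∈ om -> n ⊆ om.
Proof.
  apply (om_ind (P := fun n => n ⊆ om)).
  - dfn.
  - intros x H; destruct (empE H).
  - intros m Hm H x Hx; apply scE in Hx; destruct Hx; subst; auto.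
Qed.

Lemma nat_trans n : n ∈ om -> forall m, m ∈ n -> m ⊆ n.
Proof.
  apply (om_ind (P := fun n => forall m, m ∈ n -> m ⊆ n)).
  - dfn.
  - intros x H; destruct (empE H).
  - intros k Hk H m Hm x Hx; apply scE; apply scE in Hm.
    destruct Hm as [Hm | ->]; [left; apply (H m)|]; auto.
Qed.

Lemma sc_mono n : n ∈ om -> forall m, m ∈ n -> sc m ∈ sc n.
Proof.
  apply (om_ind (P := fun n => forall m, m ∈ n -> sc m ∈ sc n)).
  - dfn.
  - intros x H; destruct (empE H).
  - intros k Hk H m Hm; apply scE; apply scE in Hm.
    destruct Hm as [Hm | ->]; auto.
Qed.

(** Induction on [m] with [n] fixed. The base case needs [emp] to be a member of every successor,
    and the case [m ∈ n] of the step is [sc_mono]. *)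
Lemma om_total m n : m ∈ om -> n ∈ om -> m ∈ n \/ m = n \/ n ∈ m.
Proof.
  intros Hm Hn; revert m Hm.
  assert (Z : forall k, k ∈ om -> emp ∈ sc k).
  { apply (om_ind (P := fun k => emp ∈ sc k)); [dfn | apply scE; tauto |].
    intros k _ H; apply scE; tauto. }
  apply (om_ind (P := fun m => m ∈ n \/ m = n \/ n ∈ m)).
  - dfn.
  - destruct (om_cases Hn) as [-> | (k & Hk & ->)]; auto.
  - intros m Hm [H|[<-|H]].
    + apply (sc_mono Hn), scE in H; tauto.
    + right; right; apply scE; tauto.
    + right; right; apply scE; tauto.
Qed.

Definition least (P : M -> Prop) : M :=
  pick om (fun n => P n /\ forall m, m ∈ n -> ~ P m).

(** Foundation gives a solution disjoint from the set of all solutions, so no solution lies below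
    it; [om_total] makes it unique, as [pick] requires. *)
Lemma least_spec (P : M -> Prop) n : definable (fun e => P (e 0)) ->
  n ∈ om -> P n -> least P ∈ om /\ P (least P).
Proof.
  intros D Hn HPn.
  destruct (zf_foundation HM (x := sep om P)) as (k & Hk & Dk).
  { exists n; apply sepE; auto. }
  apply sepE in Hk; [|exact D]; destruct Hk as [Hk HPk].
  assert (L : forall m, m ∈ k -> ~ P m).
  { intros m Hm HPm; apply (Dk m); split; [exact Hm|].
    apply sepE; [exact D|]; split; [|exact HPm]; exact (om_trans Hk Hm). }
  replace (least P) with k; [auto|].
  symmetry; apply pick_unique; [dfn|exact Hk|auto|].
  intros b Hb [HPb Lb].
  destruct (om_total Hb Hk) as [H|[H|H]]; [|exact H|].
  - destruct (L _ H HPb).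
  - destruct (Lb _ H HPk).
Qed.

Lemma definable_least (P : (nat -> M) -> M -> Prop) :
  definable (fun e => P (fun i => e (S i)) (e 0)) ->
  definable_term (fun e => least (P e)).
Proof.
  intro H; unfold least, pick.
  apply (definable_term_fun definable_bigU), definable_sep; [dfn|].
  apply definable_and; [exact H|].
  apply definable_all, definable_imp; [dfn|]; apply definable_not.
  apply (definable_env (fun i => match i with 0 => 0 | S j => S (S j) end) H).
Qed.

Hint Extern 0 (definable_term (fun _ => least _)) =>
  apply definable_least; cbv beta : dfn.

(** Choosing among natural numbers is provable in ZF, because [least] is definable. *)
Lemma om_choice (C : M -> M -> Prop) A :
  definable (fun e => C (e 0) (e 1)) ->
  (forall a, a ∈ A -> exists n, n ∈ om /\ C a n) ->
  exists h, forall a, a ∈ A -> app h a ∈ om /\ C a (app h a).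
Proof.
  intros D H; exists (lam A (fun a => least (C a))); intros a Ha.
  rewrite app_lam by (dfn || exact Ha).
  destruct (H a Ha) as (n & Hn & Hc); apply (least_spec (n := n)); auto; dfn.
Qed.

(** Induction on [n]: the bound obtained so far is compared with the successor of the value at [n],
    if there is one, and the larger of the two is kept. *)
Lemma om_bounded (R : M -> M -> Prop) : definable (fun e => R (e 0) (e 1)) ->
  (forall i m m', R i m -> R i m' -> m = m') ->
  forall n, n ∈ om ->
  exists k, k ∈ om /\ forall i m, i ∈ n -> m ∈ om -> R i m -> m ∈ k.
Proof.
  intros D F.
  apply (om_ind (P := fun n => exists k, k ∈ om /\
    forall i m, i ∈ n -> m ∈ om -> R i m -> m ∈ k)).
  - dfn.
  - exists emp; split; [apply emp_om|]; intros i m Hi; destruct (empE Hi).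
  - intros n Hn (k & Hk & H).
    destruct (classic (exists m, m ∈ om /\ R n m)) as [(m & Hm & Rm)|N].
    + destruct (om_total Hk (sc_om Hm)) as [L|[L|L]].
      * exists (sc m); split; [apply sc_om, Hm|]; intros i j Hi Hj Rj.
        apply scE in Hi; destruct Hi as [Hi | ->].
        -- apply (nat_trans (sc_om Hm) L), (H i); auto.
        -- apply scE; right; exact (F _ _ _ Rj Rm).
      * exists (sc m); split; [apply sc_om, Hm|]; intros i j Hi Hj Rj.
        apply scE in Hi; destruct Hi as [Hi | ->].
        -- rewrite <- L; apply (H i); auto.
        -- apply scE; right; exact (F _ _ _ Rj Rm).
      * exists k; split; [exact Hk|]; intros i j Hi Hj Rj.
        apply scE in Hi; destruct Hi as [Hi | ->]; [apply (H i); auto|].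
        rewrite (F _ _ _ Rj Rm); apply (nat_trans Hk L), scE; tauto.
    + exists k; split; [exact Hk|]; intros i j Hi Hj Rj.
      apply scE in Hi; destruct Hi as [Hi | ->]; [apply (H i); auto|].
      destruct N; eauto.
Qed.

(** If [f] injected [X] into a natural number, [om_bounded] applied to the inverse of [f] would give
    a natural number [k] above all natural numbers, so that [k ∈ k]. *)
Lemma infinite_om X : om ⊆ X -> infinite X.
Proof.
  intros H (w & n & Hw & Hn & f & [Hf Hfn] & Hi & _).
  rewrite (omega_unique Hw) in Hn.
  destruct (om_bounded (R := fun i m => maps f m i)) with (n := n)
    as (k & Hk & B); [dfn | intros i m m'; apply Hi | exact Hn |].
  assert (K := proj2 (app_on (app f k) Hf (H k Hk)) eq_refl).
  apply (@mem_irrefl k), (B (app f k)); auto; apply (Hfn k), K.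
Qed.

(** * An injection of [ω × ω] into [ω] *)

Definition iter_closed (F : M -> M) a R : Prop :=
  opr emp a ∈ R /\ forall n s, opr n s ∈ R -> opr (sc n) (F s) ∈ R.

(** The recursion theorem: the graph is the least closed relation. Cutting down to [prod om om]
    makes it a set, and it remains closed when [a] is in ω and [F] maps ω into itself. *)
Definition iter_graph (F : M -> M) a : M :=
  sep (prod om om) (fun p => forall R, iter_closed F a R -> p ∈ R).

Definition iter (F : M -> M) a n : M := app (iter_graph F a) n.

Hint Extern 0 (definable (fun _ => iter_closed _ _ _)) =>
  unfold iter_closed : dfn.
Hint Extern 0 (definable_term (fun _ => iter_graph _ _)) =>
  unfold iter_graph : dfn.

Lemma definable_iter (F : M -> M) : definable_term (fun e => F (e 0)) ->
  definable_term (fun e => iter F (e 0) (e 1)).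
Proof. intro D; unfold iter; dfn. Qed.

Hint Extern 0 (definable_term (fun _ => iter _ _ _)) =>
  refine (definable_term_fun2 (definable_iter _) _ _); cbv beta : dfn.

Section Iteration.
Variable F : M -> M.
Hypothesis DF : definable_term (fun e => F (e 0)).
Hypothesis F_om : forall n, n ∈ om -> F n ∈ om.
Variable a : M.
Hypothesis a_om : a ∈ om.

Let G := iter_graph F a.

Lemma iter_graphE :
  G ≐ {{ p | p ∈ prod om om /\ forall R, iter_closed F a R -> p ∈ R }}.
Proof. unfold G, iter_graph; apply sepE; dfn. Qed.

Lemma iter_graph_closed : iter_closed F a G.
Proof.
  split.
  - apply iter_graphE; split; [apply opr_prod; split; [apply emp_om|exact a_om]|].
    intros R []; assumption.
  - intros n s H; apply iter_graphE in H; destruct H as [H K].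
    apply opr_prod in H; apply iter_graphE; split.
    + apply opr_prod; split; [apply sc_om | apply F_om]; tauto.
    + intros R HR; pose proof (K R HR); apply HR; assumption.
Qed.

(* If [(n, s)] is not forced to be in the graph, it can be removed from it. *)
Lemma iter_graph_forced n s : opr n s ∈ G ->
  ~ iter_closed F a (sep G (fun p => p <> opr n s)).
Proof.
  intros H K; apply iter_graphE in H; apply H, sepE in K; [tauto|dfn].
Qed.

(** Closure demands only the value [a] at [emp] and only the value [F t] at [sc n], where [t] is the
    value at [n]. A pair with any other value could be deleted, contrary to minimality. *)
Lemma iter_graph_fun : forall n, n ∈ om ->
  forall s s', opr n s ∈ G -> opr n s' ∈ G -> s = s'.
Proof.
  apply (om_ind (P := fun n =>
    forall s s', opr n s ∈ G -> opr n s' ∈ G -> s = s')).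
  - unfold G; dfn.
  - enough (K : forall s, opr emp s ∈ G -> s = a)
      by (intros s s' H H'; rewrite (K s H), (K s' H'); reflexivity).
    intros s H; apply NNPP; intro N; apply (iter_graph_forced H); split.
    + apply sepE; [dfn|]; split; [apply iter_graph_closed|].
      intro E; apply opr_inj in E; destruct E; congruence.
    + intros n t L; apply sepE in L; [|dfn]; apply sepE; [dfn|].
      split; [apply iter_graph_closed; tauto|].
      intro E; apply opr_inj in E; apply (@sc_neq_emp n); tauto.
  - intros n Hn IH.
    enough (K : exists t, forall s, opr (sc n) s ∈ G -> s = F t)
      by (destruct K as [t K]; intros s s' H H';
          rewrite (K s H), (K s' H'); reflexivity).
    destruct (classic (exists t, opr n t ∈ G)) as [(t & Ht)|N0].
    + exists t; intros s H; apply NNPP; intro N.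
      apply (iter_graph_forced H); split.
      * apply sepE; [dfn|]; split; [apply iter_graph_closed|].
        intro E; apply opr_inj in E; apply (@sc_neq_emp n); symmetry; tauto.
      * intros k u L; apply sepE in L; [|dfn]; apply sepE; [dfn|].
        split; [apply iter_graph_closed; tauto|].
        intro E; apply opr_inj in E; destruct E as [E1 E2].
        apply sc_inj in E1; subst k; apply N.
        rewrite <- E2, (IH u t); tauto.
    (* With no pair at [n], nothing forces a pair at [sc n]; the witness [a] is arbitrary and every
       such pair is contradictory. *)
    + exists a; intros s H; exfalso; apply (iter_graph_forced H); split.
      * apply sepE; [dfn|]; split; [apply iter_graph_closed|].
        intro E; apply opr_inj in E; apply (@sc_neq_emp n); symmetry; tauto.
      * intros k u L; apply sepE in L; [|dfn]; apply sepE; [dfn|].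
        split; [apply iter_graph_closed; tauto|].
        intro E; apply opr_inj in E; destruct E as [E1 E2].
        apply sc_inj in E1; subst k; apply N0; exists u; tauto.
Qed.

Lemma iter_graph_app n s : n ∈ om -> opr n s ∈ G -> iter F a n = s.
Proof.
  intros Hn H; apply app_unique; [apply mapsE, H|].
  intros s' H'; apply mapsE in H'; exact (iter_graph_fun Hn H' H).
Qed.

Lemma iter_graph_total n : n ∈ om -> opr n (iter F a n) ∈ G.
Proof.
  intro Hn; enough (exists s, opr n s ∈ G) as [s Hs]
    by (rewrite (iter_graph_app Hn Hs); exact Hs).
  revert n Hn; apply (om_ind (P := fun n => exists s, opr n s ∈ G)).
  - unfold G; dfn.
  - exists a; apply iter_graph_closed.
  - intros n _ (s & H); exists (F s); apply iter_graph_closed, H.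
Qed.

Lemma iter_om n : n ∈ om -> iter F a n ∈ om.
Proof.
  intro Hn; apply iter_graph_total, iter_graphE in Hn.
  destruct Hn as [H _]; apply opr_prod in H; tauto.
Qed.

Lemma iter_emp : iter F a emp = a.
Proof. apply iter_graph_app; [apply emp_om | apply iter_graph_closed]. Qed.

Lemma iter_sc n : n ∈ om -> iter F a (sc n) = F (iter F a n).
Proof.
  intro Hn; apply iter_graph_app; [apply sc_om, Hn|].
  apply iter_graph_closed, iter_graph_total, Hn.
Qed.

End Iteration.

Definition dbl n : M := iter (fun k => sc (sc k)) emp n.

Lemma definable_dbl :
  definable_term (fun e : nat -> M => dbl (e 0)).
Proof. unfold dbl; dfn. Qed.

Hint Extern 0 (definable_term (fun _ => dbl _)) =>
  apply (definable_term_fun definable_dbl); cbv beta : dfn.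

Lemma dbl_om n : n ∈ om -> dbl n ∈ om.
Proof.
  apply iter_om; [dfn| |apply emp_om]; intros; apply sc_om, sc_om; assumption.
Qed.

Lemma dbl_emp : dbl emp = emp.
Proof.
  apply iter_emp; [dfn| |apply emp_om]; intros; apply sc_om, sc_om; assumption.
Qed.

Lemma dbl_sc n : n ∈ om -> dbl (sc n) = sc (sc (dbl n)).
Proof.
  apply (iter_sc (F := fun k => sc (sc k)));
    [dfn| |apply emp_om]; intros; apply sc_om, sc_om; assumption.
Qed.

Lemma dbl_inj : forall n, n ∈ om -> forall m, m ∈ om -> dbl n = dbl m -> n = m.
Proof.
  apply (om_ind (P := fun n => forall m, m ∈ om -> dbl n = dbl m -> n = m)).
  - dfn.
  - intros m Hm; destruct (om_cases Hm) as [-> | (k & Hk & ->)]; [reflexivity|].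
    rewrite dbl_emp, dbl_sc by exact Hk; intro E; destruct (sc_neq_emp (eq_sym E)).
  - intros n Hn IH m Hm; rewrite dbl_sc by exact Hn.
    destruct (om_cases Hm) as [-> | (k & Hk & ->)].
    + rewrite dbl_emp; intro E; destruct (sc_neq_emp E).
    + rewrite dbl_sc by exact Hk; intro E; apply sc_inj, sc_inj in E.
      f_equal; auto.
Qed.

Lemma dbl_neq_odd : forall n, n ∈ om -> forall m, m ∈ om -> dbl n <> sc (dbl m).
Proof.
  apply (om_ind (P := fun n => forall m, m ∈ om -> dbl n <> sc (dbl m))).
  - dfn.
  - intros m _; rewrite dbl_emp; intro E; destruct (sc_neq_emp (eq_sym E)).
  - intros n Hn IH m Hm; rewrite dbl_sc by exact Hn; intro E; apply sc_inj in E.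
    destruct (om_cases Hm) as [-> | (k & Hk & ->)].
    + rewrite dbl_emp in E; destruct (sc_neq_emp E).
    + rewrite dbl_sc in E by exact Hk; apply sc_inj in E; exact (IH k Hk E).
Qed.

(* [2^m (2 n + 1)]; [iter] avoids developing arithmetic. *)
Definition code m n : M := iter dbl (sc (dbl n)) m.

Lemma definable_code :
  definable_term (fun e : nat -> M => code (e 0) (e 1)).
Proof. unfold code; dfn. Qed.

Hint Extern 0 (definable_term (fun _ => code _ _)) =>
  apply (definable_term_fun2 definable_code); cbv beta : dfn.

Lemma code_om m n : m ∈ om -> n ∈ om -> code m n ∈ om.
Proof.
  intros Hm Hn; apply (iter_om (F := dbl)); [dfn|exact dbl_om| |exact Hm].
  apply sc_om, dbl_om, Hn.
Qed.

Lemma code_emp n : n ∈ om -> code emp n = sc (dbl n).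
Proof.
  intro Hn; apply (iter_emp (F := dbl)); [dfn|exact dbl_om|]; apply sc_om, dbl_om, Hn.
Qed.

Lemma code_sc m n : m ∈ om -> n ∈ om -> code (sc m) n = dbl (code m n).
Proof.
  intros Hm Hn; apply (iter_sc (F := dbl)); [dfn|exact dbl_om| |exact Hm].
  apply sc_om, dbl_om, Hn.
Qed.

(** Induction on the exponent [m]. A code is odd exactly when its exponent is [emp], so the
    exponents vanish together; otherwise one doubling is stripped from both sides. *)
Lemma code_inj m n m' n' : m ∈ om -> n ∈ om -> m' ∈ om -> n' ∈ om ->
  code m n = code m' n' -> m = m' /\ n = n'.
Proof.
  intros Hm Hn Hm' Hn'; revert m Hm m' Hm'.
  apply (om_ind (P := fun m => forall m', m' ∈ om ->
    code m n = code m' n' -> m = m' /\ n = n')).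
  - dfn.
  - intros m' Hm'; rewrite code_emp by exact Hn.
    destruct (om_cases Hm') as [-> | (k & Hk & ->)].
    + rewrite code_emp by exact Hn'; intro E; apply sc_inj, dbl_inj in E; auto.
    + rewrite code_sc by assumption; intro E; symmetry in E.
      apply dbl_neq_odd in E; [destruct E | apply code_om | ]; assumption.
  - intros m Hm IH m' Hm'; rewrite code_sc by assumption.
    destruct (om_cases Hm') as [-> | (k & Hk & ->)].
    + rewrite code_emp by exact Hn'; intro E.
      apply dbl_neq_odd in E; [destruct E | apply code_om | ]; assumption.
    + rewrite code_sc by assumption; intro E.
      apply dbl_inj in E; try (apply code_om; assumption).
      destruct (IH k Hk E); subst; auto.
Qed.

(** * Countable sets *)

(** Only the values [app f a] for [a ∈ A] matter, so the same [f] enumerates every subset of [A] and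
    the notion needs no mention of domains. *)
Definition enumerates f A : Prop :=
  (forall a, a ∈ A -> app f a ∈ om) /\
  (forall a a', a ∈ A -> a' ∈ A -> app f a = app f a' -> a = a').

Hint Extern 0 (definable (fun _ => enumerates _ _)) =>
  unfold enumerates : dfn.

(** An element may carry several codes as long as no code is shared; [least] selects one of them. *)
Lemma countable_of_rel (C : M -> M -> Prop) A :
  definable (fun e => C (e 0) (e 1)) ->
  (forall a, a ∈ A -> exists c, c ∈ om /\ C a c) ->
  (forall a a' c, a ∈ A -> a' ∈ A -> C a c -> C a' c -> a = a') ->
  countable A.
Proof.
  intros D H I; assert (DL : definable_term (fun e => least (C (e 0)))) by dfn.
  assert (L : forall a, a ∈ A -> least (C a) ∈ om /\ C a (least (C a))).
  { intros a Ha; destruct (H a Ha) as (c & Hc & K).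
    apply (least_spec (n := c)); auto; dfn. }
  exists om, (lam A (fun a => least (C a))); split; [apply om_spec|]; split.
  - apply lam_to; [exact DL|]; intros a Ha; apply L, Ha.
  - intros a a' b K K'; apply maps_lam in K; [|exact DL].
    apply maps_lam in K'; [|exact DL].
    destruct K as [Ha ->], K' as [Ha' E].
    apply (I a a' (least (C a))); auto; [apply L, Ha|].
    rewrite E; apply L, Ha'.
Qed.

Lemma countableE A : countable A <-> exists f, enumerates f A.
Proof.
  split.
  - intros (w & f & Hw & [Hf K] & I); rewrite (omega_unique Hw) in K.
    assert (L : forall a, a ∈ A -> maps f a (app f a))
      by (intros a Ha; apply (app_on _ Hf Ha); reflexivity).
    exists f; split; [intros a Ha; exact (K _ _ (L a Ha))|].
    intros a a' Ha Ha' E; apply (I a a' (app f a)); [auto|].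
    rewrite E; auto.
  - intros (f & H & I); apply (countable_of_rel (C := fun a c => c = app f a)).
    + dfn.
    + intros a Ha; exists (app f a); auto.
    + intros a a' c Ha Ha' -> ; apply I; assumption.
Qed.

Lemma countable_subset A B : countable B -> A ⊆ B -> countable A.
Proof.
  rewrite !countableE; intros (f & H & I) S; exists f; split; auto.
Qed.

Lemma countable_emp : countable emp.
Proof.
  apply countableE; exists emp; split.
  - intros a Ha; destruct (empE Ha).
  - intros a a' Ha; destruct (empE Ha).
Qed.

Lemma countable_sing x : countable (sing x).
Proof.
  apply (countable_of_rel (C := fun _ c => c = emp)).
  - dfn.
  - intros a _; exists emp; split; [apply emp_om|reflexivity].
  - intros a a' c Ha Ha' _ _; apply singE in Ha, Ha'; congruence.
Qed.

Lemma countable_img A (F : M -> M) : definable_term (fun e => F (e 0)) ->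
  countable A -> countable (img A F).
Proof.
  intros D; rewrite countableE; intros (f & H & I).
  apply (countable_of_rel
    (C := fun y c => exists x, x ∈ A /\ y = F x /\ c = app f x)).
  - dfn.
  - intros y Hy; apply imgE in Hy; [|exact D]; destruct Hy as (x & Hx & ->).
    exists (app f x); split; [auto|]; exists x; auto.
  - intros y y' c _ _ (x & Hx & -> & ->) (x' & Hx' & -> & E).
    rewrite (I x x'); auto.
Qed.

(** The first argument of [code] records which enumeration is used; a common element of [A] and [B]
    just has two codes. *)
Lemma countable_cup A B : countable A -> countable B -> countable (cup A B).
Proof.
  rewrite countableE, countableE; intros (f & H & I) (g & K & J).
  apply (countable_of_rel (C := fun x c =>
    (x ∈ A /\ c = code emp (app f x)) \/
    (x ∈ B /\ c = code (sc emp) (app g x)))).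
  - dfn.
  - assert (E0 := emp_om); assert (E1 := sc_om E0).
    intros x Hx; apply cupE in Hx; destruct Hx as [Hx|Hx];
      eexists; (split; [|eauto]); apply code_om; auto.
  - assert (E0 := emp_om); assert (E1 := sc_om E0).
    intros x x' c _ _ [[Hx ->]|[Hx ->]] [[Hx' E]|[Hx' E]];
      apply code_inj in E; auto; destruct E as [E E']; auto.
    + destruct (sc_neq_emp (eq_sym E)).
    + destruct (sc_neq_emp E).
Qed.

Lemma denumerable_img (F : M -> M) : definable_term (fun e => F (e 0)) ->
  (forall m n, m ∈ om -> n ∈ om -> F m = F n -> m = n) ->
  denumerable (img om F).
Proof.
  intros D I; exists om; split; [apply om_spec|].
  (* The bijection onto ω is the inverse of [F], written directly as a set of pairs. *)
  assert (E : forall a b, maps (img om (fun n => opr (F n) n)) a b <->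
    b ∈ om /\ a = F b).
  { intros a b; rewrite mapsE, imgE by dfn; split.
    - intros (x & Hx & E); apply opr_inj in E; destruct E; subst; auto.
    - intros [Hb ->]; eauto. }
  exists (img om (fun n => opr (F n) n)); split; [split; [split|]|split].
  - intros p Hp; apply imgE in Hp; [|dfn]; destruct Hp as (n & Hn & ->).
    exists (F n), n; rewrite is_oprE, imgE by dfn; eauto.
  - intros a Ha; apply imgE in Ha; [|exact D]; destruct Ha as (n & Hn & ->).
    exists n; split; [apply E; auto|].
    intros b Hb; apply E in Hb; destruct Hb; auto.
  - intros a b H; apply E in H; tauto.
  - intros a a' b H H'; apply E in H, H'; destruct H, H'; congruence.
  - intros b Hb; exists (F b); apply E; auto.
Qed.

Lemma denumerable_countable A : denumerable A -> countable A.
Proof.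
  intros (w & Hw & f & Hf & I & _); exists w, f; auto.
Qed.

(** * Consequences of countable choice *)

(* Tagging the candidates for [n] with [n] makes the family injective. *)
Lemma CAC_om (R : M -> M -> Prop) B : CAC M ->
  definable (fun e => R (e 0) (e 1)) ->
  (forall n, n ∈ om -> exists w, w ∈ B /\ R n w) ->
  exists h, forall n, n ∈ om -> app h n ∈ B /\ R n (app h n).
Proof.
  intros HC D H.
  pose (G := fun n => img (sep B (R n)) (fun w => opr n w)).
  assert (DG : definable_term (fun e => G (e 0))) by (unfold G; dfn).
  assert (GE : forall n p, p ∈ G n <-> exists w, w ∈ B /\ R n w /\ p = opr n w).
  { intros n p; unfold G; rewrite imgE by dfn.
    split; intros (w & K); exists w; rewrite sepE in * by dfn; tauto. }
  destruct (HC (img om G)) as (f & Hf & Hc).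
  - apply denumerable_img; [exact DG|]; intros m n Hm Hn E.
    (* [G m] is nonempty, and the tag carried by any of its members recovers [m]. *)
    destruct (H m Hm) as (w & Hw & Rw).
    assert (K : opr m w ∈ G n) by (rewrite <- E; apply GE; eauto).
    apply GE in K; destruct K as (w' & _ & _ & K); apply opr_inj in K; tauto.
  - intros x Hx; apply imgE in Hx; [|exact DG]; destruct Hx as (n & Hn & ->).
    destruct (H n Hn) as (w & Hw & Rw); exists (opr n w); apply GE; eauto.
  (* The element chosen from [G n] is a tagged pair; [pick] strips the tag. *)
  - exists (lam om (fun n => pick B (fun w => opr n w = app f (G n)))).
    intros n Hn; rewrite app_lam by (dfn || exact Hn).
    assert (K : maps f (G n) (app f (G n))).
    { apply (app_on _ Hf); [apply imgE; eauto|reflexivity]. }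
    apply Hc, GE in K; destruct K as (w & Hw & Rw & E).
    rewrite (pick_unique (a := w)); auto; [dfn|].
    intros b _ Eb; rewrite E in Eb; apply opr_inj in Eb; tauto.
Qed.

Lemma CAC_countable (R : M -> M -> Prop) A B : CAC M ->
  definable (fun e => R (e 0) (e 1)) -> countable A ->
  (forall a, a ∈ A -> exists w, w ∈ B /\ R a w) ->
  exists h, forall a, a ∈ A -> app h a ∈ B /\ R a (app h a).
Proof.
  intros HC D HA H; apply countableE in HA; destruct HA as (k & Hk & I).
  destruct (classic (exists a, a ∈ A)) as [(a0 & Ha0)|N];
    [|exists emp; intros a Ha; destruct N; eauto].
  destruct (CAC_om (R := fun n w => forall a, a ∈ A -> app k a = n -> R a w)
    (B := B) HC) as (h & Hh).
  - dfn.
  - intros n Hn; destruct (classic (exists a, a ∈ A /\ app k a = n))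
      as [(a & Ha & E)|N].
    + destruct (H a Ha) as (w & Hw & Rw); exists w; split; [exact Hw|].
      intros a' Ha' E'; rewrite (I a' a); congruence.
    (* An index that enumerates no element of [A] imposes no condition; a witness for [a0] serves as
       the default in [B]. *)
    + destruct (H a0 Ha0) as (w & Hw & _); exists w; split; [exact Hw|].
      intros a Ha E; destruct N; eauto.
  - exists (lam A (fun a => app h (app k a))); intros a Ha.
    rewrite app_lam by (dfn || exact Ha).
    destruct (Hh (app k a) (Hk a Ha)) as [L L']; auto.
Qed.

(** Countability of each set is not enough for the union: enumerations have to be chosen too. So
    pairs of a set [z] and an enumeration of it are chosen, and a point of the union is coded by the
    index of [a] and its position in the set chosen for [a]. The last conclusion traces each point
    of [u] back to some [z] related to a member of [A], so that properties tested pointwise pass to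
    [u]. *)
Lemma CAC_union (R : M -> M -> Prop) A X Z : CAC M ->
  is_countable_subsets Z X ->
  definable (fun e => R (e 0) (e 1)) -> countable A ->
  (forall a, a ∈ A -> exists z, z ∈ Z /\ R a z) ->
  exists u, u ∈ Z /\
    (forall a, a ∈ A -> exists z, z ∈ Z /\ R a z /\ z ⊆ u) /\
    (forall x, x ∈ u -> exists a z, a ∈ A /\ z ∈ Z /\ R a z /\ x ∈ z).
Proof.
  intros HC HZ D HA H.
  destruct (CAC_countable (R := fun a w => exists z g, w = opr z g /\
    R a z /\ enumerates g z) (A := A) (B := prod Z (pw (prod X om))) HC)
    as (h & Hh).
  - dfn.
  - exact HA.
  - intros a Ha; destruct (H a Ha) as (z & Hz & Rz).
    destruct (proj1 (HZ z) Hz) as [zX zc].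
    apply countableE in zc; destruct zc as (g & Hg & I).
    assert (DG : definable_term (fun e : nat -> M => app g (e 0))) by dfn.
    (* Restricting the enumeration to [z] makes it a subset of [prod X om], so that all candidates
       belong to one set. *)
    exists (opr z (lam z (app g))); rewrite opr_prod, pwE; split; [split|].
    + exact Hz.
    + intros p Hp; unfold lam in Hp; apply imgE in Hp; [|dfn].
      destruct Hp as (x & Hx & ->); apply opr_prod; auto.
    + exists z, (lam z (app g)); split; [reflexivity|]; split; [exact Rz|].
      split; intros x; [intro Hx | intros x' Hx Hx'];
        rewrite !app_lam by assumption; auto.
  - apply countableE in HA; destruct HA as (k & Hk & Ik).
    pose (member x a g := exists z, app h a = opr z g /\ x ∈ z).
    assert (uE := sepE X (P := fun x => exists a g, a ∈ A /\ member x a g)).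
    set (u := sep X _) in uE; specialize (uE ltac:(unfold member; dfn)).
    assert (L : forall a z g, a ∈ A -> app h a = opr z g ->
      z ∈ Z /\ R a z /\ enumerates g z).
    { intros a z g Ha E; destruct (Hh a Ha) as [K (z' & g' & E' & K')].
      rewrite E in E', K; apply opr_inj in E'; destruct E'; subst z' g'.
      apply opr_prod in K; tauto. }
    exists u; split; [|split].
    + apply HZ; split; [intros x Hx; apply uE in Hx; tauto|].
      apply (countable_of_rel (C := fun x c => exists a g, a ∈ A /\
        member x a g /\ c = code (app k a) (app g x))).
      * unfold member; dfn.
      * intros x Hx; apply uE in Hx; destruct Hx as (_ & a & g & Ha & z & E & Hx).
        destruct (L a z g Ha E) as (_ & _ & Hg & _).
        exists (code (app k a) (app g x)); split; [apply code_om; auto|].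
        exists a, g; split; [exact Ha|]; split; [|reflexivity]; exists z; auto.
      * intros x x' c _ _ (a & g & Ha & (z & E & Hx) & ->)
          (a' & g' & Ha' & (z' & E' & Hx') & Ec).
        destruct (L a z g Ha E) as (_ & _ & Hg & Ig).
        destruct (L a' z' g' Ha' E') as (_ & _ & Hg' & _).
        apply code_inj in Ec; auto; destruct Ec as [Ea Ec].
        apply Ik in Ea; auto; subst a'; rewrite E in E'; apply opr_inj in E'.
        destruct E'; subst; auto.
    + intros a Ha; destruct (Hh a Ha) as [_ (z & g & E & _)].
      destruct (L a z g Ha E) as (Hz & Rz & _); exists z; split; [exact Hz|].
      split; [exact Rz|]; intros x Hx; apply uE; split.
      * apply (proj1 (HZ z) Hz), Hx.
      * exists a, g; split; [exact Ha|]; exists z; auto.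
    + intros x Hx; apply uE in Hx; destruct Hx as (_ & a & g & Ha & z & E & Hx).
      destruct (L a z g Ha E) as (Hz & Rz & _); exists a, z; auto.
Qed.

Lemma choice_of_countable_meet F z : countable z ->
  (forall x, x ∈ F -> exists a, a ∈ x /\ a ∈ z) ->
  exists f, function_on f F /\ forall x y, maps f x y -> y ∈ x.
Proof.
  intros Hz H; apply countableE in Hz; destruct Hz as (g & Hg & I).
  destruct (om_choice (C := fun x n => exists a, a ∈ x /\ a ∈ z /\ app g a = n)
    (A := F)) as (h & Hh).
  - dfn.
  - intros x Hx; destruct (H x Hx) as (a & Ha & Haz).
    exists (app g a); split; [apply Hg, Haz|eauto].
  - assert (D : definable_term (fun e : nat -> M =>
      pick z (fun a => app g a = app h (e 0)))) by dfn.
    exists (lam F (fun x => pick z (fun a => app g a = app h x))).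
    split; [apply lam_on, D|].
    intros x y K; apply maps_lam in K; [|exact D]; destruct K as [Hx ->].
    destruct (Hh x Hx) as (_ & a & Ha & Haz & E).
    rewrite (pick_unique (a := a)); auto; [dfn|].
    intros b Hb Eb; apply I; congruence.
Qed.

(** * Countable choice and the σ-ideal of countable subsets *)

Definition countable_subsets X : M := sep (pw X) (fun z => countable z).

Lemma definable_countable : definable (fun e : nat -> M => countable (e 0)).
Proof.
  apply definable_ext with (fun e => exists f, enumerates f (e 0)); [|dfn].
  intro e; symmetry; apply countableE.
Qed.

Lemma countable_subsetsE X : is_countable_subsets (countable_subsets X) X.
Proof.
  intro z; unfold countable_subsets; rewrite (sepE _ definable_countable), pwE.
  reflexivity.
Qed.

Lemma CAC_CMC : CAC M -> CMC_aleph0_infty M.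
Proof.
  intros HC F HF Hne.
  destruct (CAC_countable (R := fun x w => w ∈ x) (A := F) (B := bigU F) HC)
    as (h & Hh).
  - dfn.
  - exact HF.
  - intros x Hx; destruct (Hne x Hx) as (a & Ha); exists a; split; [|exact Ha].
    apply bigUE; eauto.
  - exists (lam F (fun x => sing (app h x))); split; [apply lam_on; dfn|].
    intros x y K; apply maps_lam in K; [|dfn]; destruct K as [Hx ->].
    split; [exists (app h x); apply singE; reflexivity|].
    split; [apply countable_sing|]; intros a Ha; apply singE in Ha; subst a.
    apply Hh, Hx.
Qed.

Lemma countable_subsets_emp X Z : is_countable_subsets Z X -> emp ∈ Z.
Proof.
  intro HZ; apply HZ; split; [|apply countable_emp].
  intros a Ha; destruct (empE Ha).
Qed.

Lemma countable_subsets_cup X Z : is_countable_subsets Z X ->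
  forall x y, x ∈ Z -> y ∈ Z -> cup x y ∈ Z.
Proof.
  intros HZ x y Hx Hy; apply HZ in Hx, Hy; apply HZ; split.
  - intros a Ha; apply cupE in Ha; destruct Ha; [apply Hx | apply Hy]; auto.
  - apply countable_cup; tauto.
Qed.

Lemma countable_om : countable om.
Proof.
  apply (countable_of_rel (C := fun a c => a = c)); [dfn|eauto|congruence].
Qed.

Lemma CAC_sigma_ideal : CAC M -> countable_subsets_sigma_ideal M.
Proof.
  intros HC X Z _ HZ; split; [split; [|split]|].
  - exists emp; split; [apply empE | apply (countable_subsets_emp HZ)].
  - intros x y Hx S; apply HZ in Hx; apply HZ; split.
    + intros a Ha; apply Hx, S, Ha.
    + apply (countable_subset (proj2 Hx) S).
  - intros x y u Hx Hy Hu.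
    replace u with (cup x y) by
      (apply set_ext; intro a; rewrite (Hu a); apply cupE).
    apply (countable_subsets_cup HZ Hx Hy).
  - intros w s u Hw [Hs K] Hu; rewrite (omega_unique Hw) in *.
    (* Each [n] has the single candidate [app s n]; choice is spent only on the enumerations. *)
    destruct (CAC_union (R := maps s) (A := om) HC HZ) as (v & Hv & Sv & _).
    + dfn.
    + apply countable_om.
    + intros n Hn; exists (app s n).
      assert (L : maps s n (app s n)) by (apply (app_on _ Hs Hn); reflexivity).
      split; [apply (K _ _ L) | exact L].
    + assert (S : u ⊆ v).
      { intros a Ha; apply Hu in Ha; destruct Ha as (n & x & L & Ha).
        assert (Hn := maps_dom Hs L).
        destruct (Sv n Hn) as (z & Hz & L' & S); apply S.
        apply (app_on _ Hs Hn) in L, L'; congruence. }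
      apply HZ in Hv; apply HZ; split.
      * intros a Ha; apply Hv, S, Ha.
      * apply (countable_subset (proj2 Hv) S).
Qed.

Lemma sigma_ideal_CAC :
  CMC_aleph0_infty M -> countable_subsets_sigma_ideal M -> CAC M.
Proof.
  intros HM' HS F HF Hne; assert (Fc := denumerable_countable HF).
  destruct (HM' F Fc Hne) as (f & Hf & Hc).
  pose (X := cup om (bigU F)).
  assert (HX : infinite X)
    by (apply infinite_om; intros n Hn; apply cupE; tauto).
  destruct (HS X _ HX (countable_subsetsE X)) as [_ HU].
  destruct HF as (w & Hw & g & Hg & gI & gS); rewrite (omega_unique Hw) in *.
  (* A σ-ideal is closed under unions of sequences on ω, so the countable sets [app f x] are
     reindexed through the inverse of the bijection [g]. *)
  pose (inv n := pick F (fun x => maps g x n)).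
  assert (Dg : definable_term (fun e => inv (e 0))) by (unfold inv; dfn).
  assert (gE : forall x, x ∈ F -> maps g x (app g x))
    by (intros x Hx; apply (app_on _ (proj1 Hg) Hx); reflexivity).
  assert (invE : forall x, x ∈ F -> inv (app g x) = x).
  { intros x Hx; apply pick_unique; [dfn|exact Hx|auto|].
    intros b _ Hb; apply (gI _ _ _ Hb (gE x Hx)). }
  assert (fE : forall x, x ∈ F -> nonempty (app f x) /\
    app f x ∈ countable_subsets X /\ app f x ⊆ x).
  { intros x Hx; assert (L := proj2 (app_on (app f x) Hf Hx) eq_refl).
    destruct (Hc _ _ L) as (H1 & H2 & H3); split; [exact H1|].
    split; [|exact H3]; apply countable_subsetsE; split; [|exact H2].
    intros a Ha; apply cupE; right; apply bigUE; eauto. }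
  pose (s := lam om (fun n => app f (inv n))).
  assert (Ds : definable_term (fun e => app f (inv (e 0)))) by dfn.
  pose (u := sep X (fun a => exists n x, maps s n x /\ a ∈ x)).
  assert (sF : function_to s om (countable_subsets X)).
  { apply lam_to; [exact Ds|]; intros n Hn.
    destruct (gS n Hn) as (x & Hx); assert (xF := maps_dom (proj1 Hg) Hx).
    apply (app_on _ (proj1 Hg) xF) in Hx; rewrite Hx, invE by exact xF.
    exact (proj1 (proj2 (fE x xF))). }
  assert (uE : u ≐ {{ a | exists n x, maps s n x /\ a ∈ x }}).
  { intro a; unfold u; rewrite sepE by dfn; split; [tauto|].
    intros (n & x & L & Ha); split; [|eauto].
    assert (K := proj2 sF _ _ L); apply countable_subsetsE in K; apply K, Ha. }
  assert (uc := HU om s u om_spec sF uE); apply countable_subsetsE in uc.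
  apply (choice_of_countable_meet (proj2 uc)); intros x Hx.
  destruct (fE x Hx) as ((a & Ha) & _ & S); exists a; split; [apply S, Ha|].
  apply uE; exists (app g x), (app f x); split; [|exact Ha].
  apply maps_lam; [exact Ds|]; rewrite invE by exact Hx; split; [|reflexivity].
  apply (proj2 Hg _ _ (gE x Hx)).
Qed.

(** * The two spaces *)

Section Neighbourhoods.
Variables (X Z S T : M) (adm : M -> M -> Prop) (nbhd : M -> M -> M -> Prop).

(* Common form of both topologies: [adm x z] says that [z] may be used at [x],
   and the [y] with [nbhd x z y] form the basic neighbourhood of [x]. *)
Definition nbhd_open V : Prop :=
  V ⊆ S /\ forall x, x ∈ V -> exists z, z ∈ Z /\ adm x z /\
    forall y, y ∈ S -> nbhd x z y -> y ∈ V.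

Hypothesis HZ : is_countable_subsets Z X.
Hypothesis HT : forall V, V ∈ T <-> nbhd_open V.

(** The last two hypotheses capture what both spaces share: admissibility can be checked point by
    point, and enlarging [z] shrinks the neighbourhood. Two open sets are then handled by [cup] and
    countably many by [CAC_union]. *)
Lemma P_space_of_CAC : CAC M ->
  (forall x, definable (fun e => adm x (e 0))) ->
  (forall x, definable (fun e => nbhd x (e 0) (e 1))) ->
  (forall x u, (forall a, a ∈ u -> exists z, adm x z /\ a ∈ z) -> adm x u) ->
  (forall x z u y, z ⊆ u -> nbhd x u y -> nbhd x z y) ->
  P_space S T.
Proof.
  intros HC DA DN A_union N_mono; split; [split; [|split; [|split]]|].
  - intros U HU; apply HT, HU.
  - apply HT; split; [intros x Hx; exact Hx|]; intros x Hx.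
    (* The empty set is admissible at every point, vacuously by [A_union]. *)
    exists emp; split; [apply (countable_subsets_emp HZ)|]; split; [|auto].
    apply A_union; intros a Ha; destruct (empE Ha).
  - intros U V W HU HV HW; apply HT in HU, HV; apply HT.
    destruct HU as [US HU], HV as [_ HV]; split.
    { intros x Hx; apply HW in Hx; apply US; tauto. }
    intros x Hx; apply HW in Hx; destruct Hx as [Ux Vx].
    destruct (HU x Ux) as (z & Hz & Az & Nz).
    destruct (HV x Vx) as (z' & Hz' & Az' & Nz').
    exists (cup z z'); split; [apply (countable_subsets_cup HZ); assumption|].
    split.
    + apply A_union; intros a Ha; apply cupE in Ha; destruct Ha; eauto.
    + intros y Hy Ny; apply HW; split; [apply Nz|apply Nz']; auto;
        refine (N_mono _ _ _ _ _ Ny); intros a Ha; apply cupE; auto.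
  - intros A W HA HW; apply HT; split.
    + intros x Hx; apply HW in Hx; destruct Hx as (U & HU & Hx).
      apply HA, HT in HU; apply HU, Hx.
    + intros x Hx; apply HW in Hx; destruct Hx as (U & HU & Hx).
      assert (OU := HU); apply HA, HT in OU.
      destruct (proj2 OU x Hx) as (z & Hz & Az & Nz).
      exists z; split; [exact Hz|]; split; [exact Az|].
      intros y Hy Ny; apply HW; exists U; auto.
  - intros G (A & HA & Ac & HG); apply HT; split.
    { intros x Hx; apply HG in Hx; tauto. }
    intros x Hx; apply HG in Hx; destruct Hx as [Sx Hx].
    pose proof (DA x) as DAx; pose proof (DN x) as DNx.
    destruct (CAC_union (R := fun U z => adm x z /\
      forall y, y ∈ S -> nbhd x z y -> y ∈ U) (A := A) HC HZ)
      as (u & Hu & Hsub & Hcov).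
    + dfn.
    + exact Ac.
    + intros U HU; assert (OU := HU); apply HA, HT in OU; apply OU, Hx, HU.
    + exists u; split; [exact Hu|]; split.
      * apply A_union; intros a Ha.
        destruct (Hcov a Ha) as (U & z & _ & _ & [Az _] & Haz); eauto.
      * intros y Hy Ny; apply HG; split; [exact Hy|]; intros U HU.
        destruct (Hsub U HU) as (z & _ & [_ Nz] & Hzu).
        apply Nz; [exact Hy|]; exact (N_mono _ _ _ _ Hzu Ny).
Qed.

(* The sets [{ y | W y a for some a ∈ x }] with [x ∈ F] are open, and a
   countable [z] giving a neighbourhood of [x0] inside their intersection meets
   every [x ∈ F]. *)
Lemma choice_of_P_space (W : M -> M -> Prop) x0 F : P_space S T ->
  definable (fun e => W (e 0) (e 1)) ->
  (forall y a, y ∈ S -> a ∈ X -> W y a ->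
     adm y (sing a) /\ forall y', nbhd y (sing a) y' -> W y' a) ->
  x0 ∈ S -> (forall a, a ∈ X -> W x0 a) ->
  (forall z, z ∈ Z -> exists y, y ∈ S /\ nbhd x0 z y /\
     forall a, a ∈ X -> W y a -> a ∈ z) ->
  countable F -> (forall x, x ∈ F -> nonempty x) -> bigU F ⊆ X ->
  exists f, function_on f F /\ forall x y, maps f x y -> y ∈ x.
Proof.
  intros [_ HP] DW W_open Sx0 Wx0 W_sep Fc Fne FX.
  pose (O x := sep S (fun y => exists a, a ∈ x /\ W y a)).
  assert (OE : forall x, O x ≐ {{ y | y ∈ S /\ exists a, a ∈ x /\ W y a }})
    by (intro x; apply sepE; dfn).
  assert (DO : definable_term (fun e => O (e 0))) by (unfold O; dfn).
  assert (XF : forall x a, x ∈ F -> a ∈ x -> a ∈ X)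
    by (intros x a Hx Ha; apply FX, bigUE; eauto).
  pose (G := sep S (fun y => forall U, U ∈ img F O -> y ∈ U)).
  assert (GE : G ≐ {{ y | y ∈ S /\ forall U, U ∈ img F O -> y ∈ U }})
    by (apply sepE; dfn).
  assert (GT : G ∈ T).
  { apply HP; exists (img F O); split; [|split; [|exact GE]].
    - intros U HU; apply imgE in HU; [|exact DO]; destruct HU as (x & Hx & ->).
      apply HT; split; [intros y Hy; apply OE in Hy; tauto|].
      intros y Hy; apply OE in Hy; destruct Hy as (Hy & a & Ha & Wa).
      destruct (W_open y a Hy (XF x a Hx Ha) Wa) as [Aa Na].
      (* Whether [W y a] holds is controlled by [y] at the single point [a], so the singleton
         already gives a neighbourhood. *)
      exists (sing a); split; [|split; [exact Aa|]].
      + apply HZ; split; [|apply countable_sing].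
        intros b Hb; apply singE in Hb; subst b; eauto.
      + intros y' Hy' Ny; apply OE; eauto.
    - apply countable_img; assumption. }
  apply HT in GT; destruct GT as [_ GT]; destruct (GT x0) as (z & Hz & _ & Nz).
  { apply GE; split; [exact Sx0|]; intros U HU.
    apply imgE in HU; [|exact DO]; destruct HU as (x & Hx & ->).
    destruct (Fne x Hx) as (a & Ha); apply OE.
    split; [exact Sx0|]; exists a; split; [exact Ha|]; eauto. }
  (* The point [y] lies in the neighbourhood given by [z], hence in every [O x], while [W y a] holds
     only for [a ∈ z]; so each [x] meets [z]. *)
  destruct (W_sep z Hz) as (y & Hy & Ny & Wy).
  apply (choice_of_countable_meet (proj2 (proj1 (HZ z) Hz))).
  intros x Hx; specialize (Nz y Hy Ny); apply GE in Nz; destruct Nz as [_ Nz].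
  specialize (Nz (O x)); rewrite imgE, OE in Nz by exact DO.
  destruct Nz as (_ & a & Ha & Wa); eauto.
Qed.

End Neighbourhoods.

Lemma CAC_of_infinite_sets :
  (forall X F, infinite X -> countable F -> (forall x, x ∈ F -> nonempty x) ->
     bigU F ⊆ X ->
     exists f, function_on f F /\ forall x y, maps f x y -> y ∈ x) ->
  CAC M.
Proof.
  intros H F HF Hne; apply (H (cup om (bigU F))).
  - apply infinite_om; intros n Hn; apply cupE; tauto.
  - apply denumerable_countable, HF.
  - exact Hne.
  - intros a Ha; apply cupE; tauto.
Qed.

(** * The space on the power set of [X] *)

Definition SP_nbhd x z y : Prop := x ⊆ y /\ disjoint y z.

Lemma SP_openE X Z S V : is_power S X ->
  (V ⊆ S /\ forall x, x ∈ V -> exists z, z ∈ Z /\ disjoint x z /\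
     exists d, is_diff d X z /\
       forall y, y ∈ S -> x ⊆ y -> y ⊆ d -> y ∈ V) <->
  nbhd_open Z S (@disjoint M) SP_nbhd V.
Proof.
  intro HS; split; intros [VS H]; (split; [exact VS|]); intros x Hx;
    destruct (H x Hx) as (z & Hz & Dz & K); exists z; (split; [exact Hz|]);
    (split; [exact Dz|]).
  - destruct K as (d & Hd & K); intros y Hy [xy yz]; apply K; auto.
    intros a Ha; apply Hd; split; [apply HS in Hy; auto|].
    intro L; apply (yz a); auto.
  - exists (sep X (fun a => a ∉ z)); split; [intro a; apply sepE; dfn|].
    intros y Hy xy yd; apply K; [exact Hy|]; split; [exact xy|].
    intros a [La Lz]; apply yd, sepE in La; [tauto|dfn].
Qed.

(** This allows Separation to form the topology as a set, to which the P-space hypothesis is then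
    applied. *)
Lemma definable_nbhd_open Z S (adm : M -> M -> Prop) (nbhd : M -> M -> M -> Prop) :
  definable (fun e => adm (e 0) (e 1)) ->
  definable (fun e => nbhd (e 0) (e 1) (e 2)) ->
  definable (fun e => nbhd_open Z S adm nbhd (e 0)).
Proof.
  intros DA DN; unfold nbhd_open.
  apply definable_and; [dfn|].
  apply definable_all, definable_imp, definable_ex, definable_and; [dfn..|].
  apply definable_and; [dfn|].
  apply definable_all, definable_imp; [dfn|]; apply definable_imp; [|dfn].
  exact (definable_env (fun i => match i with 0 => 2 | 1 => 1 | _ => 0 end) DN).
Qed.

Lemma CAC_SP : CAC M -> SP_spaces_P M.
Proof.
  intros HC X Z S T _ HZ [HS HT].
  apply (P_space_of_CAC (adm := @disjoint M) (nbhd := SP_nbhd) HZ); auto.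
  - intro V; rewrite (HT V); apply SP_openE, HS.
  - intro x; dfn.
  - intro x; unfold SP_nbhd; dfn.
  - intros x u H a [Ha Hu]; destruct (H a Hu) as (z & D & Hz).
    apply (D a); auto.
  - intros x z u y S' [xy yu]; split; [exact xy|].
    intros a [Ha Hz]; apply (yu a); auto.
Qed.

Lemma SP_CAC : SP_spaces_P M -> CAC M.
Proof.
  intro H; apply CAC_of_infinite_sets; intros X F HX Fc Fne FX.
  pose (T := sep (pw (pw X))
    (nbhd_open (countable_subsets X) (pw X) (@disjoint M) SP_nbhd)).
  assert (TE : forall V, V ∈ T <->
    nbhd_open (countable_subsets X) (pw X) (@disjoint M) SP_nbhd V).
  { intro V; unfold T; rewrite sepE, pwE; [unfold nbhd_open; tauto|].
    apply definable_nbhd_open; unfold SP_nbhd; dfn. }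
  assert (HS : is_power (pw X) X) by (intro x; apply pwE).
  apply (choice_of_P_space (countable_subsetsE X) TE
    (W := fun y a => a ∉ y) (x0 := emp)); auto.
  - apply (H X _ _ _ HX (countable_subsetsE X)); split; [exact HS|].
    intro V; rewrite (SP_openE _ V HS); apply TE.
  - dfn.
  - intros y a _ _ Ha; split.
    + intros b [Hb Eb]; apply singE in Eb; subst b; auto.
    + intros y' [_ D] Ha'; apply (D a); rewrite singE; auto.
  - apply pwE; intros a Ha; destruct (empE Ha).
  - intros a _; apply empE.
  (* The complement of [z] is the largest member of the neighbourhood of the empty set given by [z];
     it omits only those points of [X] that lie in [z]. *)
  - intros z Hz; exists (sep X (fun a => a ∉ z)); rewrite pwE.
    split; [|split; [split|]].
    + intros a Ha; apply sepE in Ha; [tauto|dfn].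
    + intros a Ha; destruct (empE Ha).
    + intros a [Ha Haz]; apply sepE in Ha; [tauto|dfn].
    + intros a Ha K; rewrite sepE in K by dfn; apply NNPP; tauto.
Qed.

(** * The space [2^X[Z]] *)

Definition cube_nbhd f z g : Prop :=
  forall a b, a ∈ z -> maps f a b -> maps g a b.

(** A cylinder over [z] containing [f] is given by the restriction of [f] to [z], so its members are
    the functions agreeing with [f] on [z], and every [z] is admissible. The neighbourhood form also
    allows an empty [z]; adding one point of [X] restores nonemptiness and only shrinks the
    neighbourhood. *)
Lemma cube_openE X Z S V t : infinite X -> is_countable_subsets Z X ->
  is_function_space S X t ->
  (V ⊆ S /\ forall f, f ∈ V -> exists z, z ∈ Z /\ nonempty z /\
     exists p c, function_to p z t /\ is_cylinder S c p /\ f ∈ c /\ c ⊆ V) <->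
  nbhd_open Z S (fun _ _ => True) cube_nbhd V.
Proof.
  intros HX HZ HS; split; intros [VS H]; (split; [exact VS|]);
    intros f Hf; destruct (H f Hf) as (z & Hz & K).
  - destruct K as (_ & p & c & [[Hp _] _] & Hc & fc & cV).
    exists z; split; [exact Hz|]; split; [exact I|]; intros g Hg N.
    apply cV, Hc; split; [exact Hg|]; intros q Hq.
    destruct (Hp q Hq) as (a & b & Ha & E); apply is_oprE in E; subst q.
    apply mapsE, (N a b Ha), mapsE; apply Hc in fc; apply fc, Hq.
  - destruct K as [_ K].
    assert (Xne : exists x0, x0 ∈ X).
    (* An empty [X] would be equipotent to the natural number [emp], hence finite. *)
    { apply NNPP; intro N; apply HX; exists om, emp.
      split; [apply om_spec|]; split; [apply emp_om|].
      exists emp; split; [split; [split|]|split].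
      - intros p Hp; destruct (empE Hp).
      - intros a Ha; destruct N; eauto.
      - intros a b L; apply mapsE in L; destruct (empE L).
      - intros a a' b L; apply mapsE in L; destruct (empE L).
      - intros b Hb; destruct (empE Hb). }
    destruct Xne as (x0 & Hx0).
    pose (z' := cup z (sing x0)).
    assert (Hz' : z' ∈ Z).
    { apply (countable_subsets_cup HZ Hz), HZ; split; [|apply countable_sing].
      intros a Ha; apply singE in Ha; subst a; exact Hx0. }
    (* [p] is the restriction of [f] to [z']. *)
    pose (p := sep f (fun q => exists a b, a ∈ z' /\ q = opr a b)).
    assert (pE : forall a b, maps p a b <-> a ∈ z' /\ maps f a b).
    { intros a b; rewrite !mapsE; unfold p; rewrite sepE by dfn; split.
      - intros (L & a' & b' & Ha & E); apply opr_inj in E; destruct E; subst.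
        auto.
      - intros [Ha L]; split; [exact L|]; eauto. }
    assert (Sf := VS f Hf); apply HS in Sf; destruct Sf as [fX ft].
    exists z'; split; [exact Hz'|].
    split; [exists x0; apply cupE; rewrite singE; auto|].
    exists p, (sep S (fun g => p ⊆ g)).
    assert (cE : is_cylinder S (sep S (fun g => p ⊆ g)) p)
      by (intro g; apply sepE; dfn).
    split; [split; [split|]|split; [exact cE|split]].
    + intros q Hq; unfold p in Hq; apply sepE in Hq; [|dfn].
      destruct Hq as (_ & a & b & Ha & ->); exists a, b; rewrite is_oprE; auto.
    + intros a Ha; apply HZ in Hz'; destruct Hz' as [Hz' _].
      assert (aX := Hz' a Ha); exists (app f a); split.
      * apply pE; split; [exact Ha|]; apply (app_on _ fX aX); reflexivity.
      * intros b Hb; apply pE in Hb; symmetry; apply (app_on _ fX aX), Hb.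
    + intros a b L; apply pE in L; apply (ft a b), L.
    + apply cE; split; [exact (VS f Hf)|].
      intros q Hq; unfold p in Hq; apply sepE in Hq; [tauto|dfn].
    + intros g Hg; apply cE in Hg; destruct Hg as [Sg pg].
      apply K; [exact Sg|]; intros a b Ha L.
      apply mapsE, pg, mapsE, pE; split; [apply cupE; auto|exact L].
Qed.

Lemma CAC_cube : CAC M -> cube_spaces_P M.
Proof.
  intros HC X Z S T HX HZ (t & _ & HS & HT).
  apply (P_space_of_CAC (adm := fun _ _ => True) (nbhd := cube_nbhd) HZ); auto.
  - intro V; rewrite (HT V); apply (cube_openE V HX HZ HS).
  - intro x; dfn.
  - intro x; unfold cube_nbhd; dfn.
  - intros x z u y S' N a b Ha; apply N, S', Ha.
Qed.

Lemma is_two_upr : is_two (upr emp (sing emp)).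
Proof.
  intro x; rewrite uprE; split; intros [H|H].
  - left; subst; apply empE.
  - right; subst x; intro y; rewrite singE; split; [intros ->; apply empE|].
    apply emp_unique.
  - left; apply emp_unique, H.
  - right; apply set_ext; intro y; rewrite (H y), singE; split;
      [apply emp_unique|intros ->; apply empE].
Qed.

Lemma cube_CAC : cube_spaces_P M -> CAC M.
Proof.
  intro H; apply CAC_of_infinite_sets; intros X F HX Fc Fne FX.
  pose (t := upr emp (sing emp)).
  pose (S := sep (pw (prod X t)) (fun f => function_to f X t)).
  assert (HS : is_function_space S X t).
  { intro f; unfold S; rewrite sepE, pwE.
    - split; [tauto|]; intros [Hf K]; split; [|split; assumption].
      intros p Hp; destruct (proj1 Hf p Hp) as (a & b & Ha & E).
      apply is_oprE in E; subst p; apply opr_prod; split; [exact Ha|].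
      apply (K a b), mapsE, Hp.
    - unfold function_to, function_on, is_opair; dfn. }
  pose (T := sep (pw S)
    (nbhd_open (countable_subsets X) S (fun _ _ => True) cube_nbhd)).
  assert (TE : forall V, V ∈ T <->
    nbhd_open (countable_subsets X) S (fun _ _ => True) cube_nbhd V).
  { intro V; unfold T; rewrite sepE, pwE; [unfold nbhd_open; tauto|].
    apply definable_nbhd_open; unfold cube_nbhd; dfn. }
  apply (choice_of_P_space (countable_subsetsE X) TE
    (W := fun y a => maps y a emp) (x0 := lam X (fun _ => emp))); auto.
  - apply (H X _ _ _ HX (countable_subsetsE X)); exists t.
    split; [apply is_two_upr|]; split; [exact HS|].
    intro V; rewrite (cube_openE V HX (countable_subsetsE X) HS); apply TE.
  - dfn.
  - intros y a _ _ Ha; split; [exact I|].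
    intros y' N; apply N; [apply singE; reflexivity|exact Ha].
  - apply HS, lam_to; [dfn|]; intros a _; apply uprE; auto.
  - intros a Ha; apply maps_lam; [dfn|auto].
  (* [g] takes the value 0 on [z] and 1 elsewhere. Writing it as a subset of [sing emp] makes it
     definable without a case distinction. *)
  - intros z Hz; pose (g a := sep (sing emp) (fun _ => a ∉ z)).
    assert (Dg : definable_term (fun e => g (e 0))) by (unfold g; dfn).
    assert (gE : forall a b, b ∈ g a <-> b = emp /\ a ∉ z)
      by (intros a b; unfold g; rewrite sepE, singE by dfn; reflexivity).
    exists (lam X g); split; [|split].
    + apply HS, lam_to; [exact Dg|]; intros a _; apply uprE.
      destruct (classic (a ∈ z)) as [Ha|Ha].
      * left; apply emp_unique; intros b Hb; apply gE in Hb; tauto.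
      * right; apply set_ext; intro b; rewrite gE, singE; tauto.
    + intros a b Ha L; apply maps_lam in L; [|dfn]; destruct L as [aX ->].
      apply maps_lam; [exact Dg|]; split; [exact aX|].
      symmetry; apply emp_unique; intros b Hb; apply gE in Hb; tauto.
    + intros a aX L; apply maps_lam in L; [|exact Dg]; destruct L as [_ E].
      apply NNPP; intro N; apply (@empE emp); rewrite E at 2; apply gE; auto.
Qed.

End Model.

Theorem theorem6p1 (M : set_structure) (HM : ZF_model M) :
  (CAC M <-> CMC_aleph0_infty M /\ countable_subsets_sigma_ideal M) /\
  (CAC M <-> cube_spaces_P M) /\
  (CAC M <-> SP_spaces_P M).
Proof.
  split; [|split]; split.
  - intro HC; split; [apply CAC_CMC | apply CAC_sigma_ideal]; assumption.
  - intros [HC HS]; apply sigma_ideal_CAC; assumption.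
  - apply CAC_cube, HM.
  - apply cube_CAC, HM.
  - apply CAC_SP, HM.
  - apply SP_CAC, HM.
Qed.
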